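(* Let $H$ be a Hilbert module over a $C^*$-algebra. For every idempotent $Q\in\mathcal{L}(H)$, with matched projection $m(Q)$, we have $$\tfrac12 \left\|P_{\mathcal{R}(Q)}-Q\right\|\le \left\|m(Q)-Q\right\|\le\left\|P_{\mathcal{R}(Q)}-Q\right\|.$$ Moreover, each of the two inequalities is an equality if and only if $Q$ is a projection.
   Context: $\mathcal{L}(H)$ is the $C^*$-algebra of adjointable operators on the Hilbert $C^*$-module $H$, and $I$ is the identity operator on $H$. $\mathcal{R}(\cdot)$ and $\mathcal{N}(\cdot)$ denote range and null space. An idempotent is $Q\in\mathcal{L}(H)$ with $Q^2=Q$; a projection is a self-adjoint idempotent. $P_{\mathcal{R}(Q)}$ is the projection of $H$ onto the (orthogonally complemented) range of $Q$. Definition of the matched projection $m(Q)$ of an idempotent $Q\in\mathcal{L}(H)$: if $Q$ is a projection, $m(Q)=Q$. Otherwise, $H=\mathcal{R}(Q)\dotplus\mathcal{N}(Q^* )$ is an orthogonal decomposition; let $U:H\to\mathcal{R}(Q)\oplus\mathcal{N}(Q^* )$ be the unitary $Uh=\binom{P_{\mathcal{R}(Q)}h}{(I-P_{\mathcal{R}(Q)})h}$, let $I_1$ be the identity on $\mathcal{R}(Q)$, let $A=(Q-P_{\mathcal{R}(Q)})|_{\mathcal{N}(Q^* )}:\mathcal{N}(Q^* )\to\mathcal{R}(Q)$ and $B=(AA^*+I_1)^{1/2}$, and set $$m(Q)=U^*\cdot\frac12\begin{pmatrix}(B+I_1)B^{-1} & B^{-1}A\\ A^*B^{-1} & A^*[B(B+I_1)]^{-1}A\end{pmatrix}\cdot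 U .$$ *)

(* Defs.v *)
From HB Require Import structures.
From mathcomp Require Import all_boot all_order all_algebra.
From mathcomp Require Import complex.
From mathcomp Require Import all_classical all_reals all_analysis.
Set Implicit Arguments.
Unset Strict Implicit.
Unset Printing Implicit Defensive.
Import Order.TTheory GRing.Theory Num.Theory.
Import numFieldNormedType.Exports.
Local Open Scope classical_set_scope.
Local Open Scope ring_scope.
Local Open Scope complex_scope.

(* C*-algebras over the complex numbers R[i]; no unit is assumed, so the
   product is not the one of a MathComp ring. *)
Record cstarAlgebra (R : realType) := CstarAlgebra {
  cs_car :> completeNormedModType R[i];
  cs_mul : cs_car -> cs_car -> cs_car;
  cs_star : cs_car -> cs_car;
  cs_mulA : forall a b c, cs_mul a (cs_mul b c) = cs_mul (cs_mul a b) c;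
  cs_mulDl : forall a b c, cs_mul (a + b) c = cs_mul a c + cs_mul b c;
  cs_mulDr : forall a b c, cs_mul a (b + c) = cs_mul a b + cs_mul a c;
  cs_scalel : forall k a b, cs_mul (k *: a) b = k *: cs_mul a b;
  cs_scaler : forall k a b, cs_mul a (k *: b) = k *: cs_mul a b;
  cs_starK : forall a, cs_star (cs_star a) = a;
  cs_starD : forall a b, cs_star (a + b) = cs_star a + cs_star b;
  cs_starZ : forall k a, cs_star (k *: a) = k^* *: cs_star a;
  cs_starM : forall a b, cs_star (cs_mul a b) = cs_mul (cs_star b) (cs_star a);
  cs_normM : forall a b, `|cs_mul a b| <= `|a| * `|b|;
  cs_cstar : forall a, `|cs_mul (cs_star a) a| = `|a| ^+ 2
}.

Section InnerProductModules.
Context {R : realType} {A : cstarAlgebra R}.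

Definition cs_pos (a : A) := exists b : A, a = cs_mul (cs_star b) b.

(* Norms in a normedModType over R[i] are values of R[i]; this is the same
   number as an element of R. *)
Definition cs_norm (a : A) : R := complex.Re `|a|.

End InnerProductModules.

(* Right inner-product modules (pre-Hilbert modules): the inner product is
   linear in its second argument. *)
Record ipModule (R : realType) (A : cstarAlgebra R) := IpModule {
  ip_car :> lmodType R[i];
  ip_act : ip_car -> A -> ip_car;
  inner : ip_car -> ip_car -> A;
  ip_actDl : forall x y a, ip_act (x + y) a = ip_act x a + ip_act y a;
  ip_actDr : forall x a b, ip_act x (a + b) = ip_act x a + ip_act x b;
  ip_actM : forall x a b, ip_act x (cs_mul a b) = ip_act (ip_act x a) b;
  ip_actZl : forall k x a, ip_act (k *: x) a = k *: ip_act x a;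
  ip_actZr : forall k x a, ip_act x (k *: a) = k *: ip_act x a;
  innerD : forall x y z, inner x (y + z) = inner x y + inner x z;
  innerZ : forall k x y, inner x (k *: y) = k *: inner x y;
  innerA : forall x y a, inner x (ip_act y a) = cs_mul (inner x y) a;
  inner_star : forall x y, cs_star (inner x y) = inner y x;
  inner_pos : forall x, cs_pos (inner x x);
  inner_eq0 : forall x, inner x x = 0 -> x = 0
}.

Section Norm.
Context {R : realType} {A : cstarAlgebra R}.

Definition ip_norm {E : ipModule A} (x : E) : R := Num.sqrt (cs_norm (inner x x)).

Definition ip_complete (E : ipModule A) := forall u : nat -> E,
  (forall e : R, 0 < e -> exists N : nat,
     forall m n : nat, (N <= m)%N -> (N <= n)%N -> ip_norm (u m - u n) < e) ->
  exists l : E, forall e : R, 0 < e -> exists N : nat,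
     forall n : nat, (N <= n)%N -> ip_norm (u n - l) < e.

End Norm.

Record hilbertModule (R : realType) (A : cstarAlgebra R) := HilbertModule {
  hm_ip :> ipModule A;
  hm_complete : ip_complete hm_ip
}.

Section InnerTheory.
Context {R : realType} {A : cstarAlgebra R} {E : ipModule A}.
Implicit Types x y z : E.

Lemma innerDl x y z : inner (x + y) z = inner x z + inner y z.
Proof. by rewrite -inner_star innerD cs_starD !inner_star. Qed.

Lemma innerZl k x y : inner (k *: x) y = k^* *: inner x y.
Proof. by rewrite -inner_star innerZ cs_starZ inner_star. Qed.

Lemma inner0 x : inner x 0 = 0.
Proof. by rewrite -(scale0r (0 : E)) innerZ scale0r. Qed.

Lemma inner0l x : inner 0 x = 0.
Proof.
apply: (@addrI _ (inner 0 x)).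
by rewrite -innerDl !addr0.
Qed.

Lemma inner_inj x y : (forall z, inner z x = inner z y) -> x = y.
Proof.
move=> h; apply/eqP; rewrite -subr_eq0; apply/eqP/inner_eq0.
by rewrite innerD h -innerD addrN inner0.
Qed.

End InnerTheory.

Section AdjointableOperators.
Context {R : realType} {A : cstarAlgebra R}.

Definition adjoint_of {E F : ipModule A} (T : E -> F) (S : F -> E) :=
  forall x y, inner (T x) y = inner x (S y).

Section Def.
Variables E F : ipModule A.

Definition adjointable : set (E -> F) :=
  [set T | exists S : F -> E, adjoint_of T S].

Lemma adjointable_closed :
  subsemimod_closed [pred T : E -> F | T \in adjointable].
Proof.
apply: GRing.submod_closed_semi; split.
  by rewrite inE; exists 0 => x y; rewrite inner0 inner0l.
move=> k T1 T2; rewrite !inE => -[S1 h1] [S2 h2].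
exists (k^* *: S1 + S2) => x y.
by rewrite innerDl innerZl h1 h2 innerD innerZ.
Qed.

(* L(E, F); linearity over R[i] and over A is automatic, see linop_linear and
   linop_act below *)
Record linop := Linop { linop_fun :> E -> F; _ : linop_fun \in adjointable }.
HB.instance Definition _ := [isSub for linop_fun].
HB.instance Definition _ := [Choice of linop by <:].
HB.instance Definition _ := GRing.SubChoice_isSubLmodule.Build
  _ _ _ linop adjointable_closed.

End Def.

Definition lid {E : ipModule A} : linop E E.
Proof. by exists id; rewrite inE; exists id. Defined.

Definition lcomp {E F G : ipModule A} (S : linop F G) (T : linop E F) :
  linop E G.
Proof.
exists (S \o T); rewrite inE.
have /set_mem[S' hS] := valP S; have /set_mem[T' hT] := valP T.
by exists (T' \o S') => x y /=; rewrite hS hT.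
Defined.

Lemma adj_subproof {E F : ipModule A} (T : linop E F) :
  {S : F -> E | adjoint_of T S}.
Proof. by apply: cid; have /set_mem := valP T. Qed.

Definition adj {E F : ipModule A} (T : linop E F) : linop F E.
Proof.
exists (sval (adj_subproof T)); rewrite inE; exists T => x y.
by rewrite -inner_star -(svalP (adj_subproof T)) inner_star.
Defined.

Lemma adjP {E F : ipModule A} (T : linop E F) x y :
  inner (T x) y = inner x (adj T y).
Proof. exact: (svalP (adj_subproof T)). Qed.

Lemma adjPr {E F : ipModule A} (T : linop E F) x y :
  inner y (T x) = inner (adj T y) x.
Proof. by rewrite -inner_star adjP inner_star. Qed.

Lemma linop_linear {E F : ipModule A} (T : linop E F) k x y :
  T (k *: x + y) = k *: T x + T y.
Proof. by apply: inner_inj => z; rewrite adjPr !innerD !innerZ !adjPr. Qed.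

Lemma linop_act {E F : ipModule A} (T : linop E F) x a :
  T (ip_act x a) = ip_act (T x) a.
Proof. by apply: inner_inj => z; rewrite adjPr !innerA adjPr. Qed.

Lemma linop0 {E F : ipModule A} (T : linop E F) : T 0 = 0.
Proof. by apply: inner_inj => z; rewrite adjPr !inner0. Qed.

Lemma ip_act0 {E : ipModule A} a : ip_act (0 : E) a = 0.
Proof. by have := ip_actZl 0 (0 : E) a; rewrite !scale0r. Qed.

Definition opnorm {E F : ipModule A} (T : linop E F) : R :=
  sup [set ip_norm (T x) | x in [set x : E | ip_norm x <= 1]].

Definition is_idempotent {E : ipModule A} (Q : linop E E) := lcomp Q Q = Q.

Definition is_projection {E : ipModule A} (Q : linop E E) :=
  is_idempotent Q /\ adj Q = Q.

Definition op_pos {E : ipModule A} (T : linop E E) :=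
  exists S : linop E E, T = lcomp (adj S) S.

(* The next three operations are defined by choice; their value is 0 when no
   operator has the stated property. *)
Definition op_sqrt {E : ipModule A} (T : linop E E) : linop E E :=
  xget 0 [set S | op_pos S /\ lcomp S S = T].

Definition op_inv {E : ipModule A} (T : linop E E) : linop E E :=
  xget 0 [set S | lcomp S T = lid /\ lcomp T S = lid].

Definition range_proj {E : ipModule A} (Q : linop E E) : linop E E :=
  xget 0 [set P | is_projection P /\ range P = range Q].

End AdjointableOperators.

Notation "S *L T" := (lcomp S T) (at level 40, left associativity).

Section Submodules.
Context {R : realType} {A : cstarAlgebra R}.

Record submodule (E : ipModule A) := Submodule {
  sub_set :> set E;
  sub_lin : subsemimod_closed [pred x : E | x \in sub_set];
  sub_act : forall x a, sub_set x -> sub_set (ip_act x a)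
}.

Section SubIp.
Context {E : ipModule A} (S : submodule E).

Record sub_type := SubType { sub_val : E; _ : sub_val \in sub_set S }.
HB.instance Definition _ := [isSub for sub_val].
HB.instance Definition _ := [Choice of sub_type by <:].
HB.instance Definition _ := GRing.SubChoice_isSubLmodule.Build
  _ _ _ sub_type (sub_lin S).

Lemma sub_act_subproof (x : sub_type) a : ip_act (\val x) a \in sub_set S.
Proof. by rewrite inE; apply: sub_act; apply: set_mem; apply: valP. Qed.

Definition sub_ip : ipModule A.
Proof.
refine (@IpModule R A sub_type
  (fun x a => SubType (sub_act_subproof x a))
  (fun x y => inner (\val x) (\val y)) _ _ _ _ _ _ _ _ _ _ _).
- by move=> x y a; apply: val_inj; rewrite /= ip_actDl.
- by move=> x a b; apply: val_inj; rewrite /= ip_actDr.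
- by move=> x a b; apply: val_inj; rewrite /= ip_actM.
- by move=> k x a; apply: val_inj; rewrite /= ip_actZl.
- by move=> k x a; apply: val_inj; rewrite /= ip_actZr.
- by move=> x y z; rewrite /= innerD.
- by move=> k x y; rewrite /= innerZ.
- by move=> x y a; rewrite /= innerA.
- by move=> x y; rewrite /= inner_star.
- by move=> x; exact: inner_pos.
- by move=> x /inner_eq0 x0; apply: val_inj.
Defined.

End SubIp.

Section RangeNull.
Context {E F : ipModule A} (T : linop E F).

Lemma range_closed : subsemimod_closed [pred y : F | y \in range T].
Proof.
apply: GRing.submod_closed_semi; split.
  by rewrite inE; exists 0 => //; exact: linop0.
move=> k _ _ /set_mem[x _ <-] /set_mem[y _ <-]; rewrite inE.
by exists (k *: x + y) => //; exact: linop_linear.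
Qed.

Lemma range_act y a : range T y -> range T (ip_act y a).
Proof. by case=> x _ <-; exists (ip_act x a) => //; exact: linop_act. Qed.

Definition op_range : submodule F := Submodule range_closed range_act.

Definition null_set : set E := [set x | T x = 0].

Lemma null_closed : subsemimod_closed [pred x : E | x \in null_set].
Proof.
apply: GRing.submod_closed_semi; split; first by rewrite inE; exact: linop0.
move=> k x y /set_mem Tx /set_mem Ty; rewrite inE /null_set /=.
by rewrite linop_linear Tx Ty scaler0 addr0.
Qed.

Lemma null_act x a : null_set x -> null_set (ip_act x a).
Proof. by rewrite /null_set /= linop_act => ->; exact: ip_act0. Qed.

Definition op_null : submodule E := Submodule null_closed null_act.

End RangeNull.
End Submodules.

Section MatchedProjection.
Context {R : realType} {A : cstarAlgebra R}.

(* f as an element of L(E, F); 0 if f is not adjointable *)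
Definition to_linop {E F : ipModule A} (f : E -> F) : linop E F :=
  insubd (0 : linop E F) f.

(* x as an element of S; 0 if x is not in S *)
Definition to_sub {E : ipModule A} (S : submodule E) (x : E) : sub_ip S :=
  insubd (0 : sub_type S) x.

Section Formula.
Context {E : ipModule A}.
Variable Q : linop E E.

(* R(Q) and N(Q^* ) as modules *)
Definition range_mod : ipModule A := sub_ip (op_range Q).
Definition null_mod : ipModule A := sub_ip (op_null (adj Q)).

(* the two components of U : E -> R(Q) (+) N(Q^* ) *)
Definition matched_U1 : linop E range_mod :=
  to_linop (fun h => to_sub (op_range Q) (range_proj Q h)).
Definition matched_U2 : linop E null_mod :=
  to_linop (fun h => to_sub (op_null (adj Q)) ((lid - range_proj Q) h)).

Definition matched_A : linop null_mod range_mod :=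
  to_linop (fun y : null_mod =>
    to_sub (op_range Q) ((Q - range_proj Q) (sub_val y))).

Definition matched_B : linop range_mod range_mod :=
  op_sqrt (matched_A *L adj matched_A + lid).

(* U^* M U for the operator matrix M = (M11 & M12 // M21 & M22) *)
Definition matched_formula : linop E E :=
  let A := matched_A in let B := matched_B in
  let U1 := matched_U1 in let U2 := matched_U2 in
  let M11 := (B + lid) *L op_inv B in
  let M12 := op_inv B *L A in
  let M21 := adj A *L op_inv B in
  let M22 := adj A *L op_inv (B *L (B + lid)) *L A in
  (2^-1 : R[i]) *: (adj U1 *L (M11 *L U1 + M12 *L U2)
                  + adj U2 *L (M21 *L U1 + M22 *L U2)).

Definition matched_proj : linop E E :=
  if `[< is_projection Q >] then Q else matched_formula.

End Formula.
End MatchedProjection.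

(* Main.v *)
(** Write [P] for the range projection of [Q], [n = Q - P], [K = 2 Q - 1] and
    [J = 2 m(Q) - 1].  Then [J] is a selfadjoint unitary and [D = J K] is
    positive, i.e. [K = J D] is the polar decomposition of the involution [K].
    Hence [m(Q) - Q = J (1 - D) / 2].  Put [s = |K| = |D|] and [a = |n|].  Since
    [D^-1 = J D J] we have [1/s <= D <= s], so [|D - 1| = s - 1]; moreover
    [2 a = |K - K*| = |D - D^-1| = s - 1/s].  Thus
    [|m(Q) - Q| = (s - 1) / 2] where [s - 1/s = 2 a], and this lies strictly
    between [a / 2] and [a] unless [a = 0].

    The operator-norm facts need positivity in C*-algebras, starting with
    Cauchy-Schwarz in a Hilbert module.  Square roots come from the iteration
    [y <- (x + y^2) / 2], and positivity is tested by closeness to a scalar, so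
    that no spectral theory enters.  Applied to left multiplications on the
    coefficient algebra this gives Cauchy-Schwarz, and applied again to the
    adjointable operators on the module it gives the order facts above. *)
From HB Require Import structures.
Require Import Defs.
From mathcomp Require Import all_boot all_order all_algebra.
From mathcomp Require Import complex all_classical all_reals all_analysis.
From mathcomp Require Import ring lra.
Set Implicit Arguments.
Unset Strict Implicit.
Unset Printing Implicit Defensive.
Import Order.TTheory GRing.Theory Num.Theory.
Import numFieldNormedType.Exports.
Local Open Scope classical_set_scope.
Local Open Scope ring_scope.
Local Open Scope complex_scope.

(** * Identities in noncommutative rings *)

(** Cauchy-Schwarz in a Hilbert module rests on positivity in a C*-algebra, while the C*-norm on
    adjointable operators rests on Cauchy-Schwarz. The circle is broken at the coefficient algebra
    as a module over itself, where Cauchy-Schwarz is submultiplicativity of the norm; its operators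
    also supply the unit that the algebra may lack. The unitary part and the modulus are explicit:
    [J = |Q| - |1 - Q|] and [D = |Q| + |1 - Q|], so that [J * J = 1] is an expansion of
    [st (Q + (1 - Q)) * (Q + (1 - Q))]. The matched projection is written with chosen roots and
    inverses on R(Q), a module that comes without a completeness proof. Witnesses for them are built
    in [L(H)] from elements commuting with the range projection and compressed to R(Q); the formula
    is then expanded back, so that the estimate takes place in a single ring. *)

Module NcRing.

Inductive exp :=
  Zero | One | Var of nat | Add of exp & exp | Opp of exp | Mul of exp & exp.

(** A signed word in the atoms, the flag being the minus sign. Terms are never collected: an
    identity of the free ring becomes a cancellation of words in pairs. *)
Definition mono := (bool * seq nat)%type.
Definition neg (m : mono) : mono := (~~ m.1, m.2).

Fixpoint norm (e : exp) : seq mono :=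
  match e with
  | Zero => [::]
  | One => [:: (false, [::])]
  | Var i => [:: (false, [:: i])]
  | Add e1 e2 => norm e1 ++ norm e2
  | Opp e1 => map neg (norm e1)
  | Mul e1 e2 => [seq (m.1 (+) m'.1, m.2 ++ m'.2) | m <- norm e1, m' <- norm e2]
  end.

(** [k] is fuel; each round deletes a word with one copy of its opposite, so the length of the list
    suffices. *)
Fixpoint cancel (k : nat) (s : seq mono) : bool :=
  match k, s with
  | _, [::] => true
  | k'.+1, m :: s' => (neg m \in s') && cancel k' (rem (neg m) s')
  | 0, _ => false
  end.

Section Eval.
Context {B : pzRingType} (v : seq B).

Fixpoint eval (e : exp) : B :=
  match e with
  | Zero => 0
  | One => 1
  | Var i => nth 0 v i
  | Add e1 e2 => eval e1 + eval e2
  | Opp e1 => - eval e1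
  | Mul e1 e2 => eval e1 * eval e2
  end.

Definition eval_mono (m : mono) : B := (-1) ^+ m.1 * \prod_(i <- m.2) nth 0 v i.

Lemma eval_neg m : eval_mono (neg m) = - eval_mono m.
Proof. by case: m => -[] w; rewrite /eval_mono /= ?expr0 ?expr1 !(mulN1r, mul1r) ?opprK. Qed.

Lemma eval_norm e : eval e = \sum_(m <- norm e) eval_mono m.
Proof.
elim: e => [||i|e1 IH1 e2 IH2|e1 IH1|e1 IH1 e2 IH2] /=.
- by rewrite big_nil.
- by rewrite big_seq1 /eval_mono big_nil mulr1.
- by rewrite big_seq1 /eval_mono big_seq1 mul1r.
- by rewrite big_cat IH1 IH2.
- by rewrite big_map IH1 -sumrN; apply: eq_bigr => m _; rewrite eval_neg.
- rewrite big_allpairs_dep IH1 IH2 big_distrl; apply: eq_bigr => m _ /=.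
  rewrite big_distrr; apply: eq_bigr => m' _ /=.
  rewrite /eval_mono /= big_cat /=.
  by case: m.1 m'.1 => -[]; rewrite /= ?expr0 ?expr1 ?(mul1r, mulN1r, mulNr, mulrN, opprK).
Qed.

Lemma eval_cancel k s : cancel k s -> \sum_(m <- s) eval_mono m = 0.
Proof.
elim: k s => [|k IH] [|m s] //=; rewrite ?big_nil // => /andP[ms /IH h].
by rewrite big_cons (perm_big _ (perm_to_rem ms)) big_cons h /= addr0 eval_neg subrr.
Qed.

Lemma eval_eq e1 e2 :
  (let s := norm (Add e1 (Opp e2)) in cancel (size s) s) -> eval e1 = eval e2.
Proof. by move=> /eval_cancel; rewrite -eval_norm /= => /eqP; rewrite subr_eq0 => /eqP. Qed.

End Eval.

Ltac lookup x v :=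
  lazymatch v with
  | x :: _ => constr:(O)
  | _ :: ?v' => let n := lookup x v' in constr:(S n)
  end.

Ltac mem x v :=
  lazymatch v with
  | x :: _ => constr:(true)
  | _ :: ?v' => mem x v'
  | _ => constr:(false)
  end.

Ltac atoms e v :=
  lazymatch e with
  | @GRing.zero _ => v
  | @GRing.one _ => v
  | @GRing.add _ ?a ?b => let v' := atoms a v in atoms b v'
  | @GRing.mul _ ?a ?b => let v' := atoms a v in atoms b v'
  | @GRing.opp _ ?a => atoms a v
  | _ => lazymatch mem e v with true => v | false => constr:(e :: v) end
  end.

Ltac reify e v :=
  lazymatch e with
  | @GRing.zero _ => constr:(Zero)
  | @GRing.one _ => constr:(One)
  | @GRing.add _ ?a ?b =>
      let a' := reify a v in let b' := reify b v in constr:(Add a' b')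
  | @GRing.mul _ ?a ?b =>
      let a' := reify a v in let b' := reify b v in constr:(Mul a' b')
  | @GRing.opp _ ?a => let a' := reify a v in constr:(Opp a')
  | _ => let i := lookup e v in constr:(Var i)
  end.

End NcRing.

Ltac ncring :=
  lazymatch goal with
  | |- @eq ?T ?a ?b =>
    let v0 := NcRing.atoms a (@nil T) in
    let v := NcRing.atoms b v0 in
    let a' := NcRing.reify a v in
    let b' := NcRing.reify b v in
    exact (@NcRing.eval_eq _ v a' b' isT)
  end.

(* To prove [x = y] modulo relations, [z] is chosen as a combination of the
   relations such that [x - y = z] holds in the free ring. *)
Lemma eq_subr (B : zmodType) (x y z : B) : z = 0 -> x - y = z -> x = y.
Proof. by move=> -> /eqP; rewrite subr_eq0 => /eqP. Qed.

(** * Positivity in unital C*-algebras *)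

(* The scalars act through the central morphism [c], and not through an
   [algType], because the operators on the zero module form a trivial ring. *)
Record cstar_axioms (R : realType) (B : pzRingType) (c : {rmorphism R[i] -> B})
    (st : B -> B) (N : B -> R) : Prop := CstarAxioms {
  scalC : forall k x, c k * x = x * c k;
  stD : forall x y, st (x + y) = st x + st y;
  stM : forall x y, st (x * y) = st y * st x;
  stK : forall x, st (st x) = x;
  stc : forall k, st (c k) = c k^*;
  nrmD : forall x y, N (x + y) <= N x + N y;
  nrmM : forall x y, N (x * y) <= N x * N y;
  nrmc : forall k x, N (c k * x) = complex.Re `|k| * N x;
  nrm_star : forall x, N (st x * x) = N x ^+ 2;
  nrm_eq0 : forall x, N x = 0 -> x = 0;
  nrm_complete : forall u : nat -> B,
    (forall e : R, 0 < e -> exists n0, forall m n, (n0 <= m)%N -> (n0 <= n)%N ->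
       N (u m - u n) < e) ->
    exists l, forall e : R, 0 < e -> exists n0, forall n, (n0 <= n)%N ->
       N (u n - l) < e
}.

(** * Norm, adjoint and convergence *)

Section CstarTheory.
Context {R : realType} {B : pzRingType} {c : {rmorphism R[i] -> B}}.
Context {st : B -> B} {N : B -> R} (ax : cstar_axioms c st N).
Implicit Types (x y z : B) (t r : R).

Local Notation rc t := (c t%:C).
Local Notation ii := (c 'i).

Definition selfadj x := st x = x.

Lemma rcC t x : rc t * x = x * rc t. Proof. exact: (scalC ax). Qed.

Lemma iiC x : ii * x = x * ii. Proof. exact: (scalC ax). Qed.

Lemma ii2 : ii * ii = -1.
Proof. by rewrite -rmorphM -expr2 sqr_i rmorphN rmorph1. Qed.

Lemma st_rc t : st (rc t) = rc t.
Proof. by rewrite (stc ax) conjc_real. Qed.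

Lemma st_ii : st ii = - ii.
Proof. by rewrite (stc ax) -rmorphN; congr (c _); simpc. Qed.

Lemma rcD t r : rc (t + r) = rc t + rc r.
Proof. by rewrite !rmorphD. Qed.

Lemma rcB t r : rc (t - r) = rc t - rc r.
Proof. by rewrite !rmorphB. Qed.

Lemma rcM t r : rc (t * r) = rc t * rc r.
Proof. by rewrite !rmorphM. Qed.

Lemma rcCA x t y : x * (rc t * y) = rc t * (x * y).
Proof. by rewrite mulrA -rcC mulrA. Qed.

Lemma rc_sqr t x : (rc t * x) * (rc t * x) = rc (t * t) * (x * x).
Proof. by rewrite rcM -!mulrA; congr (_ * _); rewrite mulrA -rcC -mulrA. Qed.

Lemma rc1 : rc 1 = 1. Proof. by rewrite !rmorph1. Qed.

Lemma rc0 : rc 0 = 0. Proof. by rewrite !rmorph0. Qed.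

Lemma rcN t : rc (- t) = - rc t.
Proof. by rewrite !rmorphN. Qed.

Lemma half2 : rc 2^-1 + rc 2^-1 = 1.
Proof. by rewrite -rcD -rc1; congr (c _%:C); field. Qed.

Lemma nrmr t x : N (rc t * x) = `|t| * N x.
Proof. by rewrite (nrmc ax) normc_def /= expr0n addr0 sqrtr_sqr. Qed.

Lemma nrmN x : N (- x) = N x.
Proof. by rewrite -mulN1r -rc1 -rcN nrmr normrN1 mul1r. Qed.

Lemma nrm0 : N 0 = 0.
Proof. by rewrite -(mul0r 0) -rc0 nrmr normr0 mul0r. Qed.

Lemma nrm_ge0 x : 0 <= N x.
Proof. by have := nrmD ax x (- x); rewrite subrr nrm0 nrmN; lra. Qed.

Lemma nrmB x y : N (x - y) <= N x + N y.
Proof. by rewrite -(nrmN y); exact: (nrmD ax). Qed.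

Lemma nrmBC x y : N (x - y) = N (y - x).
Proof. by rewrite -nrmN opprB. Qed.

Lemma st1 : st 1 = 1. Proof. by rewrite -rc1 st_rc. Qed.

Lemma stN x : st (- x) = - st x.
Proof. by rewrite -mulN1r -rc1 -rcN (stM ax) st_rc -rcC rcN rc1 mulN1r. Qed.

Lemma st0 : st 0 = 0. Proof. by rewrite -rc0 st_rc. Qed.

Lemma stB x y : st (x - y) = st x - st y.
Proof. by rewrite (stD ax) stN. Qed.

(** Only an inequality, since [N 1 = 0] in the trivial ring. *)
Lemma nrm1 : N 1 <= 1.
Proof.
have := nrm_star ax 1; rewrite st1 mulr1 => h.
by have := nrm_ge0 1; nra.
Qed.

Lemma nrm_rc t : 0 <= t -> N (rc t) <= t.
Proof.
move=> t0; rewrite -(mulr1 (rc t)) nrmr ger0_norm //.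
by rewrite -[leRHS]mulr1 ler_wpM2l // nrm1.
Qed.

Lemma nrm_st x : N (st x) = N x.
Proof.
have h y : N y <= N (st y).
  have := nrm_star ax y; have := nrmM ax (st y) y.
  have := nrm_ge0 y; have := nrm_ge0 (st y); nra.
by apply: le_anti; rewrite h -{2}(stK ax x) h.
Qed.

Lemma nrm_sq x : selfadj x -> N (x * x) = N x ^+ 2.
Proof. by move=> h; rewrite -(nrm_star ax) h. Qed.

Definition converges (u : nat -> B) (l : B) := N (u n - l) @[n --> \oo] --> (0 : R).

Lemma cvg0_dom (f g : nat -> R) : (forall n, 0 <= f n <= g n) ->
  g n @[n --> \oo] --> (0 : R) -> f n @[n --> \oo] --> (0 : R).
Proof.
move=> fg g0; apply: (squeeze_cvgr _ _ g0); last exact: cvg_cst.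
by near=> n; exact: fg.
Unshelve. all: by end_near.
Qed.

(** A Weierstrass test: [e] is nondecreasing and bounded, and from [n] on [u] oscillates by at most
    [sup e - e n]. *)
Lemma converges_dom (u : nat -> B) (e : nat -> R) M :
  (forall n, N (u n.+1 - u n) <= e n.+1 - e n) -> (forall n, e n <= M) ->
  exists l, converges u l.
Proof.
move=> ue eM.
have e1 n : e n <= e n.+1 by have := ue n; have := nrm_ge0 (u n.+1 - u n); lra.
have umn m n : (n <= m)%N -> N (u m - u n) <= e m - e n.
  move/subnKC <-; elim: (m - n)%N => [|k IH].
    by rewrite addn0 !subrr nrm0.
  rewrite addnS.
  have -> : u (n + k).+1 - u n = (u (n + k).+1 - u (n + k)%N) + (u (n + k)%N - u n).
    by rewrite addrA subrK.
  by have := nrmD ax (u (n + k).+1 - u (n + k)%N) (u (n + k)%N - u n);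
     have := ue (n + k)%N; lra.
have emn m n : (n <= m)%N -> e n <= e m.
  by move=> /umn; have := nrm_ge0 (u m - u n); lra.
have hs : has_sup (range e).
  by split; [exists (e 0%N), 0%N|exists M => _ [n _ <-]].
case: (nrm_complete ax (u := u)) => [eps eps0|l hl].
  have [_ [n0 _ <-] hn0] := sup_adherent eps0 hs.
  exists n0.
  have es m : e m <= sup (range e) by apply: ub_le_sup; [case: hs|exists m].
  have main m n : (n0 <= m)%N -> (n0 <= n)%N -> (n <= m)%N -> N (u m - u n) < eps.
    by move=> _ /emn n0n /umn; have := es m; lra.
  move=> m n n0m n0n; case: (leqP n m) => [|/ltnW] hmn; first exact: main.
  by rewrite nrmBC; exact: main.
exists l; apply/cvgrPdist_lt => eps eps0.
have [n0 hn0] := hl _ eps0.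
by exists n0 => // n /= n0n; rewrite sub0r normrN ger0_norm ?nrm_ge0 //; exact: hn0.
Qed.

Lemma converges_cst x : converges (fun=> x) x.
Proof. by rewrite /converges subrr nrm0; exact: cvg_cst. Qed.

Lemma converges_uniq u x y : converges u x -> converges u y -> x = y.
Proof.
move=> ux uy; apply/eqP; rewrite -subr_eq0; apply/eqP/(nrm_eq0 ax).
have h : (N (u n - y) + N (u n - x)) @[n --> \oo] --> (0 : R).
  by rewrite -[0]addr0; exact: cvgD.
have /cvg_lim : (fun=> N (x - y)) @ \oo --> (0 : R).
  apply: (cvg0_dom _ h) => n; rewrite nrm_ge0 /=.
  have -> : x - y = (u n - y) - (u n - x) by ncring.
  exact: nrmB.
by rewrite lim_cst // => ->.
Qed.

Lemma convergesD u v x y : converges u x -> converges v y ->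
  converges (fun n => u n + v n) (x + y).
Proof.
move=> ux vy.
have h : (N (u n - x) + N (v n - y)) @[n --> \oo] --> (0 : R).
  by rewrite -[0]addr0; exact: cvgD.
apply: (cvg0_dom _ h) => n; rewrite nrm_ge0 /= opprD addrACA.
exact: (nrmD ax).
Qed.

Lemma convergesM u v x y : converges u x -> converges v y ->
  converges (fun n => u n * v n) (x * y).
Proof.
move=> ux vy.
have h : (N (u n - x) * N (v n - y) + N (u n - x) * N y + N x * N (v n - y))
    @[n --> \oo] --> (0 : R).
  have -> : (0 : R) = 0 * 0 + 0 * N y + N x * 0 by rewrite !(mul0r, mulr0) !addr0.
  apply: cvgD; first apply: cvgD.
  - exact: cvgM.
  - by apply: cvgM => //; exact: cvg_cst.
  - by apply: cvgM => //; exact: cvg_cst.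
apply: (cvg0_dom _ h) => n; rewrite nrm_ge0 /=.
have -> : u n * v n - x * y = (u n - x) * (v n - y) + (u n - x) * y + x * (v n - y)
  by ncring.
apply: le_trans (nrmD ax _ _) _; rewrite lerD ?(nrmM ax) //.
by apply: le_trans (nrmD ax _ _) _; rewrite lerD ?(nrmM ax).
Qed.

Lemma converges_st u x : converges u x -> converges (fun n => st (u n)) (st x).
Proof. by move=> ux; rewrite /converges; under eq_fun do rewrite -stB nrm_st. Qed.

Lemma convergesS u x : converges u x -> converges (fun n => u n.+1) x.
Proof. by move=> ux; rewrite /converges (cvg_shiftS (fun n => N (u n - x))). Qed.

Lemma converges_nrm_le u x M : converges u x -> (forall n, N (u n) <= M) -> N x <= M.
Proof.
move=> ux uM; have hM : (M + N (u n - x)) @[n --> \oo] --> M.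
  by rewrite -[X in _ --> X]addr0; apply: cvgD => //; exact: cvg_cst.
have hx : (fun _ : nat => N x) @ \oo --> N x by exact: cvg_cst.
apply: (ler_cvg_to hx hM); near=> n; have := nrmB (u n) (u n - x); rewrite subKr.
by have := uM n; lra.
Unshelve. all: by end_near.
Qed.

End CstarTheory.

(** * Square roots and positive elements *)

Section Positivity.
Context {R : realType} {B : pzRingType} {c : {rmorphism R[i] -> B}}.
Context {st : B -> B} {N : B -> R} (ax : cstar_axioms c st N).
Implicit Types (x y z : B) (t r : R).

Local Notation rc t := (c t%:C).
Local Notation ii := (c 'i).
Local Notation sa := (@selfadj B st).
Local Notation comm := GRing.comm.

Let commrc x t : comm x (rc t).
Proof. by rewrite /comm (rcC ax). Qed.

Lemma saD x y : sa x -> sa y -> sa (x + y).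
Proof. by rewrite /selfadj (stD ax) => -> ->. Qed.

Lemma saN x : sa x -> sa (- x).
Proof. by rewrite /selfadj (stN ax) => ->. Qed.

Lemma saB x y : sa x -> sa y -> sa (x - y).
Proof. by move=> hx hy; apply: saD => //; exact: saN. Qed.

Lemma saM x y : comm x y -> sa x -> sa y -> sa (x * y).
Proof. by rewrite /selfadj (stM ax) => h -> ->. Qed.

Lemma sa_rc t : sa (rc t).
Proof. exact: (st_rc ax). Qed.

Lemma sa_rcM t x : sa x -> sa (rc t * x).
Proof. by apply: saM; [exact/commr_sym/commrc|exact: sa_rc]. Qed.

Lemma sa1 : sa 1. Proof. exact: (st1 ax). Qed.

Lemma sa_sq x : sa x -> sa (x * x).
Proof. by move=> h; exact: saM. Qed.

Lemma sa_stM x : sa (st x * x).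
Proof. by rewrite /selfadj (stM ax) (stK ax). Qed.

Section Sqrt.
Variable x : B.

(** A limit [y] satisfies [y + y - y * y = x], that is [(1 - y) * (1 - y) = 1 - x]: the iteration
    yields roots of [1 - x] for [x] in the closed unit ball. *)
Fixpoint sqrt_iter (n : nat) : B :=
  if n is n'.+1 then rc 2^-1 * (x + sqrt_iter n' * sqrt_iter n') else 0.

Fixpoint sqrt_iterR (n : nat) : R :=
  if n is n'.+1 then 2^-1 * (1 + sqrt_iterR n' ^+ 2) else 0.

Lemma comm_sqrt_iter z n : comm z x -> comm z (sqrt_iter n).
Proof.
move=> zx; elim: n => [|n IH] /=; first exact: commr0.
by apply: commrM; [exact: commrc|apply: commrD => //; exact: commrM].
Qed.

Lemma sqrt_iterR_bnd n : 0 <= sqrt_iterR n <= 1.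
Proof. by elim: n => [|n /andP[IH1 IH2]] /=; rewrite ?ler01 ?lexx //=; nra. Qed.

(* The increments of the iteration for [x] are dominated by those of the
   iteration for the scalar [1], which increases to [1]. *)
Lemma sqrt_iter_dom n : N x <= 1 ->
  N (sqrt_iter n) <= sqrt_iterR n /\
  N (sqrt_iter n.+1 - sqrt_iter n) <= sqrt_iterR n.+1 - sqrt_iterR n.
Proof.
move=> x1.
have h t y : 0 <= t -> N (rc t * y) = t * N y by move=> t0; rewrite (nrmr ax) ger0_norm.
have h2 : 0 <= 2^-1 :> R by lra.
elim: n => [|n [IH1 IH2]].
  by rewrite /= (nrm0 ax) lexx mulr0 addr0 subr0 expr0n /= h //; split => //; lra.
have IH3 : N (sqrt_iter n.+1) <= sqrt_iterR n.+1.
  have := nrmD ax (sqrt_iter n) (sqrt_iter n.+1 - sqrt_iter n).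
  by rewrite addrC subrK; lra.
split => //.
set u := sqrt_iter n; set u' := sqrt_iter n.+1.
(* Commutation of the iterates turns the difference of squares below into the product of [u' - u]
   and [u' + u]. *)
have cu : comm u' u.
  by apply: commr_sym; apply: comm_sqrt_iter; apply/commr_sym/comm_sqrt_iter.
have -> : sqrt_iter n.+2 - u' = rc 2^-1 * ((u' - u) * (u' + u)).
  rewrite [X in _ - X](_ : u' = rc 2^-1 * (x + u * u)) // -mulrBr.
  congr (_ * _); change (x + u' * u' - (x + u * u) = (u' - u) * (u' + u)).
  by apply: eq_subr (_ : u * u' - u' * u = 0) _; [rewrite cu subrr|ncring].
rewrite h //.
have -> : sqrt_iterR n.+2 - sqrt_iterR n.+1 =
  2^-1 * ((sqrt_iterR n.+1 - sqrt_iterR n) * (sqrt_iterR n.+1 + sqrt_iterR n)).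
  set e := sqrt_iterR n; set e' := sqrt_iterR n.+1.
  by change (2^-1 * (1 + e' ^+ 2) - 2^-1 * (1 + e ^+ 2) = 2^-1 * ((e' - e) * (e' + e))); ring.
rewrite ler_wpM2l //; apply: le_trans (nrmM ax _ _) _.
rewrite ler_pM ?(nrm_ge0 ax) //; apply: le_trans (nrmD ax _ _) _.
exact: lerD.
Qed.

(** The commutation clause takes the place of functional calculus: it makes roots of commuting
    elements commute and later lets roots pass to a corner. *)
Lemma sqrt1m : sa x -> N x <= 1 -> exists y,
  [/\ sa y, N y <= 1, y + y - y * y = x & forall z, comm z x -> comm z y].
Proof.
move=> sx x1.
have [||y uy] := @converges_dom _ _ _ _ _ ax sqrt_iter sqrt_iterR 1.
- by move=> n; case: (sqrt_iter_dom n x1).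
- by move=> n; case/andP: (sqrt_iterR_bnd n).
exists y; split.
- apply: (converges_uniq ax (converges_st ax uy)).
  have su n : sa (sqrt_iter n).
    elim: n => [|n IH] /=; first exact: (st0 ax).
    by apply: sa_rcM; apply: saD => //; exact: sa_sq.
  by under eq_fun do rewrite su.
- apply: (converges_nrm_le ax uy) => n.
  have [h _] := sqrt_iter_dom n x1; apply: (le_trans h).
  by case/andP: (sqrt_iterR_bnd n).
- have := convergesD ax (converges_cst ax x) (convergesM ax uy uy).
  move=> /(convergesM ax (converges_cst ax (rc 2^-1))) /= h.
  have e := converges_uniq ax h (convergesS uy).
  have -> : y + y - y * y = (rc 2^-1 + rc 2^-1) * (x + y * y) - y * y.
    by rewrite mulrDl e.
  by rewrite half2 mul1r addrK.
- move=> z zx.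
  have h1 := convergesM ax (converges_cst ax z) uy.
  have h2 := convergesM ax uy (converges_cst ax z).
  apply: (converges_uniq ax h1); rewrite /converges.
  by under eq_fun do rewrite (comm_sqrt_iter _ zx).
Qed.

End Sqrt.

(** With [z = x + i y], commutation gives [st z * z = x * x + y * y]; and [x] is the real part of
    [z], whence [N x <= N z]. *)
Lemma nrm_sq_le_add x y : comm x y -> sa x -> sa y ->
  N (x * x) <= N (x * x + y * y).
Proof.
move=> xy sx sy; set z := x + ii * y.
have sz : st z = x - ii * y.
  by rewrite /z (stD ax) (stM ax) (st_ii ax) sx sy mulrN (iiC ax).
have zz : st z * z = x * x + y * y.
  rewrite sz /z.
  apply: (@eq_subr _ _ _ (x * ii * y - ii * y * x - (ii * (y * ii) * y + y * y))).
    rewrite -(iiC ax x) -(iiC ax y) [ii * (ii * y)]mulrA ii2 -!mulrA xy.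
    by rewrite mulN1r addNr subr0 subrr.
  by ncring.
rewrite -zz (nrm_star ax) (nrm_sq ax) // lerXn2r ?nnegrE ?(nrm_ge0 ax) //.
have -> : x = rc 2^-1 * (z + st z).
  have -> : z + st z = x + x by rewrite sz /z; ncring.
  by rewrite mulrDr -mulrDl half2 mul1r.
rewrite (nrmr ax) ger0_norm; last by lra.
by have := nrmD ax z (st z); rewrite (nrm_st ax); lra.
Qed.

(* Uniform closeness to a scalar is what makes sums of positive elements
   positive, without any use of the spectrum. *)
Lemma sqrt_near_scal t x : sa x -> 0 <= t -> N (rc t - x) <= t -> exists k,
  [/\ sa k, k * k = x, N (rc (Num.sqrt t) - k) <= Num.sqrt t
    & forall z, comm z x -> comm z k].
Proof.
move=> sx; rewrite le_eqVlt => /predU1P[<-|t0] h.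
  have -> : x = 0.
    apply: (nrm_eq0 ax); apply: le_anti; rewrite (nrm_ge0 ax) andbT.
    by move: h; rewrite rc0 sub0r (nrmN ax).
  exists 0; rewrite sqrtr0 rc0 subrr (nrm0 ax) mulr0; split => //.
  exact: (st0 ax).
have tn0 : t != 0 by lra.
have ti0 : 0 <= t^-1 by rewrite invr_ge0 ltW.
have st0 := sqrtr_ge0 t.
have sst : Num.sqrt t * Num.sqrt t = t by rewrite -expr2 sqr_sqrtr // ltW.
(* [1 - x / t] lies in the unit ball; its [y] gives the root [sqrt t * (1 - y)] of [x], at distance
   [sqrt t * N y] from the scalar [sqrt t]. *)
have [||y [sy y1 yy yc]] := @sqrt1m (1 - rc t^-1 * x).
- by apply: saB; [exact: sa1|exact: sa_rcM].
- have -> : 1 - rc t^-1 * x = rc t^-1 * (rc t - x).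
    by rewrite mulrBr -rcM mulVf // rc1.
  by rewrite (nrmr ax) ger0_norm // ler_pdivrMl ?mulr1.
exists (rc (Num.sqrt t) * (1 - y)); split.
- by apply: sa_rcM; apply: saB => //; exact: sa1.
- rewrite -mulrA [(1 - y) * _]mulrA -(rcC ax) !mulrA -rcM sst -mulrA.
  have -> : (1 - y) * (1 - y) = 1 - (y + y - y * y) by ncring.
  by rewrite yy subKr mulrA -rcM mulfV // rc1 mul1r.
- rewrite mulrBr mulr1 subKr (nrmr ax) ger0_norm //.
  by rewrite -[leRHS]mulr1 ler_wpM2l.
- move=> z zx; apply: commrM; first exact: commrc.
  apply: commrB; first exact: commr1.
  apply: yc; apply: commrB; first exact: commr1.
  by apply: commrM => //; exact: commrc.
Qed.

(** Squares of selfadjoint elements, the form that roots produce; that [st b * b] is of this form is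
    the content of [pos_stM]. *)
Definition pos x := exists2 k, sa k & x = k * k.

Lemma near_scal_pos t x : sa x -> 0 <= t -> N (rc t - x) <= t -> pos x.
Proof. by move=> sx t0 /(sqrt_near_scal sx t0)[k [sk <- _ _]]; exists k. Qed.

Lemma pos_sa x : pos x -> sa x.
Proof. by case=> k sk ->; exact: sa_sq. Qed.

(** [1 - x * x] is a square [(1 - y) ^ 2]; adding the commuting square [x * x] to it gives [1] and
    cannot lower the norm. *)
Lemma nrm1Bsq x : sa x -> N x <= 1 -> N (1 - x * x) <= 1.
Proof.
move=> sx x1.
have [||y [sy _ yy yc]] := @sqrt1m (x * x).
- exact: sa_sq.
- by rewrite (nrm_sq ax) // expr_le1 ?(nrm_ge0 ax).
have xy : comm x y by apply: yc; exact: commrM.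
have -> : 1 - x * x = (1 - y) * (1 - y) by rewrite -yy; ncring.
have h : N ((1 - y) * (1 - y)) <= N ((1 - y) * (1 - y) + x * x).
  apply: nrm_sq_le_add => //; last by apply: saB => //; exact: sa1.
  by apply/commr_sym/commrB => //; exact: commr1.
apply: (le_trans h).
by rewrite -yy (_ : _ + _ = 1) ?(nrm1 ax) //; ncring.
Qed.

Lemma nrm_scalBsq r x : sa x -> N x <= r -> N (rc (r ^+ 2) - x * x) <= r ^+ 2.
Proof.
move=> sx; have [r0|r0 xr] := lerP r 0.
  move=> xr; have x0 : N x = 0 by have := nrm_ge0 ax x; lra.
  have -> : r = 0 by have := nrm_ge0 ax x; lra.
  by rewrite (nrm_eq0 ax x0) expr0n rc0 mulr0 subrr (nrm0 ax).
have ri0 : 0 <= r^-1 by rewrite invr_ge0 ltW.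
have r20 : 0 <= r ^+ 2 by rewrite exprn_ge0 // ltW.
have -> : rc (r ^+ 2) - x * x =
    rc (r ^+ 2) * (1 - (rc r^-1 * x) * (rc r^-1 * x)).
  rewrite (rc_sqr ax) mulrBr mulr1 mulrA -rcM (_ : r ^+ 2 * (r^-1 * r^-1) = 1).
    by rewrite rc1 mul1r.
  by field; lra.
rewrite (nrmr ax) ger0_norm // -[leRHS]mulr1 ler_wpM2l //.
apply: nrm1Bsq; first exact: sa_rcM.
by rewrite (nrmr ax) ger0_norm // ler_pdivrMl // mulr1.
Qed.

Lemma pos_near_scal x : pos x -> exists2 t, 0 <= t & N (rc t - x) <= t.
Proof.
case=> k sk ->; exists (N k ^+ 2); first by rewrite exprn_ge0 ?(nrm_ge0 ax).
exact: nrm_scalBsq.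
Qed.

Lemma pos_nrm x : pos x -> N (rc (N x) - x) <= N x.
Proof. by case=> k sk ->; rewrite (nrm_sq ax) //; exact: nrm_scalBsq. Qed.

Lemma sqrt_pos x : pos x -> exists k,
  [/\ pos k, k * k = x & forall z, comm z x -> comm z k].
Proof.
move=> px; have [t t0 h] := pos_near_scal px.
have [k [sk kk kt kc]] := sqrt_near_scal (pos_sa px) t0 h.
exists k; split => //; apply: near_scal_pos kt => //; exact: sqrtr_ge0.
Qed.

Lemma posD x y : pos x -> pos y -> pos (x + y).
Proof.
move=> px py; have [t t0 ht] := pos_near_scal px; have [r r0 hr] := pos_near_scal py.
apply: (@near_scal_pos (t + r)); [by apply: saD; exact: pos_sa|exact: addr_ge0|].
rewrite rcD opprD addrACA; apply: le_trans (nrmD ax _ _) _.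
exact: lerD.
Qed.

Lemma pos_rc t : 0 <= t -> pos (rc t).
Proof.
move=> t0; exists (rc (Num.sqrt t)); first exact: sa_rc.
by rewrite -rcM -expr2 sqr_sqrtr.
Qed.

Lemma pos1 : pos 1. Proof. by rewrite -(@rc1 R B c); exact: pos_rc. Qed.

Lemma posM x y : comm x y -> pos x -> pos y -> pos (x * y).
Proof.
move=> xy px py.
have [k [pk kk kc]] := sqrt_pos px; have [h [ph hh hc]] := sqrt_pos py.
have kh : comm k h by apply: hc; apply/commr_sym/kc/commr_sym.
exists (k * h); first by apply: saM => //; exact: pos_sa.
by rewrite -kk -hh -!mulrA; congr (_ * _); rewrite !mulrA kh.
Qed.

Lemma pos_rcM t x : 0 <= t -> pos x -> pos (rc t * x).
Proof. by move=> t0; apply: posM; [exact/commr_sym/commrc|exact: pos_rc]. Qed.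

Lemma pos_scalB r x : sa x -> N x <= r -> pos (rc r - x).
Proof.
move=> sx xr; apply: (@near_scal_pos r).
- by apply: saB => //; exact: sa_rc.
- by have := nrm_ge0 ax x; lra.
- by rewrite subKr.
Qed.

(* Both squares sum to the scalar [r ^+ 2]. *)
Lemma nrm_le_scal r x : 0 <= r -> sa x -> pos (rc r - x) -> pos (rc r + x) ->
  N x <= r.
Proof.
move=> r0 sx p1 p2.
have cx y : comm x y -> comm x (rc r + y) by apply: commrD; exact: commrc.
have cp : comm (rc r - x) (rc r + x).
  apply: commrD; first exact: commrc.
  by apply/commr_sym/cx/commrN.
have [k [pk kk kc]] := sqrt_pos (posM cp p1 p2).
have sk := pos_sa pk.
have xk : comm x k.
  by apply: kc; apply: commrM; apply: cx => //; exact: commrN.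
have h : N (x * x) <= N (rc (r ^+ 2)).
  have -> : rc (r ^+ 2) = x * x + k * k; last exact: nrm_sq_le_add.
  rewrite kk rcM.
  apply: (@eq_subr _ _ _ (x * rc r - rc r * x)); first by rewrite (rcC ax) subrr.
  by ncring.
have := nrm_rc ax (exprn_ge0 2 r0); move: h; rewrite (nrm_sq ax) // => h h'.
by have := le_trans h h'; rewrite ler_pXn2r ?nnegrE ?(nrm_ge0 ax).
Qed.

Lemma nrm_pos_le r x : pos x -> pos (rc r - x) -> 0 <= r -> N x <= r.
Proof.
move=> px prx r0; apply: nrm_le_scal => //; first exact: pos_sa.
have -> : rc r + x = (rc r - x) + (x + x) by ncring.
by apply: posD => //; exact: posD.
Qed.

Lemma nrm_posD x y : pos x -> pos y -> N x <= N (x + y).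
Proof.
move=> px py; apply: nrm_pos_le; [by []| |exact: (nrm_ge0 ax)].
have -> : rc (N (x + y)) - x = (rc (N (x + y)) - (x + y)) + y by ncring.
by apply: posD => //; apply: pos_scalB => //; apply: pos_sa; exact: posD.
Qed.

End Positivity.

(** * Positivity of [st b * b], and inverses *)

Section StarSquares.
Context {R : realType} {B : pzRingType} {c : {rmorphism R[i] -> B}}.
Context {st : B -> B} {N : B -> R} (ax : cstar_axioms c st N).
Implicit Types (x y z : B) (t r : R).

Local Notation rc t := (c t%:C).
Local Notation ii := (c 'i).
Local Notation sa := (@selfadj B st).
Local Notation pos := (@pos B st).
Local Notation comm := GRing.comm.

Let commrc x t : comm x (rc t).
Proof. by rewrite /comm (rcC ax). Qed.

Lemma sa_sq_eq0 x : sa x -> x * x = 0 -> x = 0.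
Proof.
move=> sx xx; apply: (nrm_eq0 ax); have := nrm_sq ax sx; rewrite xx (nrm0 ax).
by move/esym/eqP; rewrite expf_eq0 => /eqP.
Qed.

(** [u] and [v] come from the Cartesian decomposition [f = u - i v]. The sum is thus seen to be
    positive before either of its two terms is. *)
Lemma stM_add_Mst f : exists u v,
  [/\ sa u, sa v & f * st f + st f * f = u * u + u * u + (v * v + v * v)].
Proof.
pose a := f + st f; pose b := ii * (f - st f).
have sa_a : sa a by rewrite /selfadj (stD ax) (stK ax) addrC.
have sa_b : sa b.
  rewrite /selfadj (stM ax) (stB ax) (stK ax) (st_ii ax) /b (iiC ax).
  by rewrite mulrN -mulNr opprB.
exists (rc 2^-1 * a), (rc 2^-1 * b); split; try exact: (sa_rcM ax).
have h x : rc 2^-1 * x * (rc 2^-1 * x) + rc 2^-1 * x * (rc 2^-1 * x) = rc 2^-1 * (x * x).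
  by rewrite (rc_sqr ax) -mulrDl -rcD; congr (c _%:C * _); field.
rewrite !h -mulrDr.
have -> : b * b = - ((f - st f) * (f - st f)).
  rewrite /b -mulrA [(f - _) * (_ * _)]mulrA -(iiC ax) -mulrA mulrA ii2.
  by rewrite mulN1r.
have -> : a * a - (f - st f) * (f - st f) =
   (f * st f + st f * f) + (f * st f + st f * f) by rewrite /a; ncring.
by rewrite mulrDr -mulrDl half2 mul1r.
Qed.

(* If [st f * f = - d] with [d >= 0], then [g = f * st f >= d] has norm
   [r = N d], and [st f * (r - g) ^ 2 * f = - d * (r + d) ^ 2] has norm at most
   [r ^ 3]; but [d * (r + d) ^ 2 >= 4 r d ^ 2] has norm at least [4 r ^ 3]. *)
Lemma stM_eqNsq f x : sa x -> st f * f = - (x * x) -> x = 0.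
Proof.
move=> sx ff; set d := x * x; set g := f * st f.
have sd : sa d by exact: (sa_sq ax).
have [u [v [su sv guv]]] := stM_add_Mst f.
have pg : pos g.
  have -> : g = d + (u * u + u * u + (v * v + v * v)).
    by rewrite -guv ff -/d -/g addrCA subrr addr0.
  by do 3?[apply: (posD ax)]; [exists x|exists u|exists u|exists v|exists v].
set r := N f ^+ 2.
have r0 : 0 <= r by rewrite exprn_ge0 ?(nrm_ge0 ax).
have gr : N g = r by rewrite /g -{1}(stK ax f) (nrm_star ax) (nrm_st ax).
have dr : N d = r by rewrite -(nrmN ax) -ff (nrm_star ax).
have rg : N (rc r - g) <= r by rewrite -gr; exact: (pos_nrm ax).
set e := rc r + d.
(* As [g * f = f * (st f * f) = - (f * d)], each factor [r - g] moves past [f] and becomes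
   [r + d]. *)
have fe : (rc r - g) * f = f * e.
  rewrite mulrBl mulrDr /g -mulrA ff mulrN opprK; congr (_ + _).
  exact: (rcC ax).
have h1 : N (st f * ((rc r - g) * ((rc r - g) * f))) <= r ^+ 3.
  apply: le_trans (nrmM ax _ _) _; rewrite (nrm_st ax).
  have -> : r ^+ 3 = N f * (r * (r * N f)) by rewrite /r; ring.
  rewrite ler_wpM2l ?(nrm_ge0 ax) //; apply: le_trans (nrmM ax _ _) _.
  rewrite ler_pM ?(nrm_ge0 ax) //; apply: le_trans (nrmM ax _ _) _.
  by rewrite ler_wpM2r ?(nrm_ge0 ax).
have xe : comm x (rc r - d).
  by apply: commrB; [exact: commrc|exact: commrM].
have xd : comm d x by apply: commr_sym; exact: commrM.
have cd : comm d (rc r - d) by apply: commrB; [exact: commrc|].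
(* Since [d = x * x], [w * w = d * (r - d) ^ 2]; with [y * y = 4 r d ^ 2] this writes
   [d * (r + d) ^ 2] as a sum of two commuting squares. *)
pose w := (rc r - d) * x.
pose y := rc (2 * Num.sqrt r) * d.
have yy : y * y = rc (2 * Num.sqrt r * (2 * Num.sqrt r)) * (d * d).
  exact: (rc_sqr ax).
have e4 : 2 * Num.sqrt r * (2 * Num.sqrt r) = 4 * r.
  have -> : 2 * Num.sqrt r * (2 * Num.sqrt r) = 4 * Num.sqrt r ^+ 2 by ring.
  by rewrite sqr_sqrtr.
have h2 : N (y * y) <= N (y * y + w * w).
  apply: (nrm_sq_le_add ax).
  - apply: commr_sym; apply: commrM; first exact: commrc.
    by apply: commr_sym; apply: commrM.
  - exact: (sa_rcM ax).
  - apply: (saM ax) => //.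
    by apply: (saB ax) => //; exact: (sa_rc ax).
have h3 : y * y + w * w = - (st f * ((rc r - g) * ((rc r - g) * f))).
  have -> : st f * ((rc r - g) * ((rc r - g) * f)) = - (d * e * e).
    by rewrite fe [_ * (f * e)]mulrA fe -[f * e * e]mulrA mulrA ff mulNr mulrA.
  rewrite opprK yy e4.
  have -> : w * w = d * ((rc r - d) * (rc r - d)).
    rewrite /w -mulrA [x * (_ * _)]mulrA xe -[_ * x * x]mulrA -/d mulrA.
    by rewrite -mulrA -cd mulrA -cd mulrA.
  have -> : rc (4 * r) = rc r + rc r + (rc r + rc r).
    by rewrite -!rcD; congr (c _%:C); ring.
  pose k := rc r * d - d * rc r.
  have k0 : k = 0 by rewrite /k (rcC ax) subrr.
  apply: (@eq_subr _ _ _ (k * d + k * d + (k * d + d * k) + (k * d + d * k))).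
    by rewrite k0 !(mul0r, mulr0, addr0).
  by rewrite /k /e; ncring.
have : 4 * r * r ^+ 2 <= r ^+ 3.
  apply: le_trans h1; rewrite -(nrmN ax) -h3; apply: le_trans h2.
  have dd : N (d * d) = r ^+ 2 by rewrite (nrm_sq ax) // dr.
  by rewrite yy e4 (nrmr ax) dd ger0_norm //; lra.
move=> h; have {h} r_0 : r = 0.
  have r3 : r ^+ 3 <= 0.
    by move: h; rewrite (_ : 4 * r * r ^+ 2 = 4 * r ^+ 3); [lra|ring].
  have : r ^+ 3 == 0 by rewrite eq_le r3 exprn_ge0.
  by rewrite expf_eq0 => /eqP.
apply: sa_sq_eq0 => //; apply: (nrm_eq0 ax); exact: etrans dr r_0.
Qed.

(** Here [m] is the modulus of [a = st b * b], [n = (m - a) / 2] the negative part of [a], and [h]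
    the root of [m]. Since [a * n = - (m * n)], the element [f = b * n] satisfies
    [st f * f = - (h * n) ^ 2], so [h * n = 0] by [stM_eqNsq]; then [m * n], [n * n] and [n] vanish
    in turn. *)
Lemma pos_stM b : pos (st b * b).
Proof.
set a := st b * b.
have sa_a : sa a by exact: (sa_stM ax).
have [m [pm mm mc]] : exists m, [/\ pos m, m * m = a * a & forall z, comm z (a * a) -> comm z m].
  by apply: (sqrt_pos ax); exists a.
have am : comm a m by apply: mc; exact: commrM.
have [h [ph hh hc]] := sqrt_pos ax pm.
have sm := pos_sa ax pm; have sh := pos_sa ax ph.
have [n nE] : exists n, n = rc 2^-1 * (m - a) by exists (rc 2^-1 * (m - a)).
have sn : sa n by rewrite nE; apply: (sa_rcM ax); exact: (saB ax).
have an : a * n = - (m * n).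
  rewrite nE !(rcCA ax) -mulrN; congr (_ * _).
  by rewrite !mulrBr mm opprB am.
have nh : comm n h.
  rewrite nE; apply: commr_sym; apply: commrM; first exact: commrc.
  apply: commrB; last by apply/commr_sym/hc.
  by apply/commr_sym/hc.
have x0 : h * n = 0.
  apply: (@stM_eqNsq (b * n)); first by apply: (saM ax) => //; exact: commr_sym.
  have -> : h * n * (h * n) = n * (m * n) by rewrite -{1}nh -hh !mulrA.
  by rewrite -mulrN -an (stM ax) sn /a -!mulrA.
have mn : m * n = 0 by rewrite -hh -mulrA x0 mulr0.
have nn : n * n = 0.
  by rewrite {1}nE -mulrA mulrBl an mn oppr0 subrr mulr0.
have n0 : n = 0.
  exact: sa_sq_eq0.
have -> : a = m; last by [].
apply/eqP; rewrite eq_sym -subr_eq0 -[m - a]mul1r -(@half2 R B c) mulrDl -nE n0 addr0 //.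
Qed.

Lemma pos_conj x y : pos x -> pos (st y * x * y).
Proof.
case=> k sk ->; have -> : st y * (k * k) * y = st (k * y) * (k * y).
  by rewrite (stM ax) sk !mulrA.
exact: pos_stM.
Qed.

(** [u n] is a partial sum of the geometric series in [v], dominated by the partial sum [e n] of the
    one in [q]. *)
Lemma neumann v q : 0 <= q < 1 -> N v <= q ->
  exists w, [/\ (1 - v) * w = 1, w * (1 - v) = 1 & forall z, comm z v -> comm z w].
Proof.
move=> /andP[q0 q1] vq.
pose u n := iter n (fun y => 1 + v * y) 0.
pose e n : R := (1 - q ^+ n) / (1 - q).
have q1' : 0 < 1 - q by lra.
have uS n : u n.+1 - u n = v ^+ n.
  elim: n => [|n IH]; first by rewrite /u /= mulr0 addr0 subr0.
  rewrite exprS -IH mulrBr.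
  change (1 + v * u n.+1 - (1 + v * u n) = v * u n.+1 - v * u n); ncring.
have vn n : N (v ^+ n) <= q ^+ n.
  elim: n => [|n IH]; first exact: (nrm1 ax).
  rewrite !exprS; apply: le_trans (nrmM ax _ _) _.
  by rewrite ler_pM ?(nrm_ge0 ax).
have [||w uw] := @converges_dom _ _ _ _ _ ax u e (1 - q)^-1.
- move=> n; rewrite uS; apply: (le_trans (vn n)); rewrite /e exprS.
  by rewrite [leRHS](_ : _ = q ^+ n) ?lexx //; field; lra.
- by move=> n; rewrite /e ler_pdivrMr // mulVf ?gt_eqF // gerBl exprn_ge0.
have wv : w = 1 + v * w.
  apply: (converges_uniq ax (convergesS uw)).
  exact: (convergesD ax (converges_cst ax 1) (convergesM ax (converges_cst ax v) uw)).
have wc z : comm z v -> comm z w.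
  move=> zv.
  have zu n : comm z (u n).
    elim: n => [|n IH]; first exact: commr0.
    by apply: commrD; [exact: commr1|exact: commrM].
  have h1 := convergesM ax (converges_cst ax z) uw.
  have h2 := convergesM ax uw (converges_cst ax z).
  apply: (converges_uniq ax h1); rewrite /converges.
  by under eq_fun do rewrite zu.
have e1 : (1 - v) * w = 1 by rewrite mulrBl mul1r {1}wv addrK.
exists w; split => //; rewrite -{2}e1; apply/commr_sym/wc.
by apply/commr_sym/commrB; [exact: commr1|].
Qed.

(** A positive [x] lies within [N x] of the scalar [N x], so [1 + x] is [t = 1 + N x] times [1 - v]
    with [N v <= N x / t < 1]. *)
Lemma pos_inv1D x : pos x -> exists w,
  [/\ pos w, (1 + x) * w = 1, w * (1 + x) = 1 & forall z, comm z x -> comm z w].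
Proof.
move=> px; set t := 1 + N x.
have t0 : 0 < t by have := nrm_ge0 ax x; rewrite /t; lra.
have ti0 : 0 <= t^-1 by rewrite invr_ge0 ltW.
pose v := rc t^-1 * (rc (N x) - x).
have vt : 1 - v = rc t^-1 * (1 + x).
  rewrite [X in X - v](_ : 1 = rc t^-1 * rc t); last first.
    by rewrite -rcM mulVf ?gt_eqF // rc1.
  by rewrite /v -mulrBr /t rcD rc1; congr (_ * _); ncring.
have [||w [w1 w2 wc]] := @neumann v (N x / t).
- rewrite divr_ge0 ?(nrm_ge0 ax) ?(ltW t0) //= ltr_pdivrMr // mul1r /t; lra.
- rewrite /v (nrmr ax) ger0_norm // mulrC ler_wpM2r //; exact: (pos_nrm ax).
have e1 : (1 + x) * (rc t^-1 * w) = 1.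
  by rewrite mulrA -(rcC ax) -vt.
have e2 : rc t^-1 * w * (1 + x) = 1.
  by rewrite (rcC ax) -mulrA -vt.
have wcc z : comm z x -> comm z (rc t^-1 * w).
  move=> zx; apply: commrM; first exact: commrc.
  by apply: wc; apply: commrM; [exact: commrc|apply: commrB => //; exact: commrc].
exists (rc t^-1 * w); split => //.
set y := rc t^-1 * w in e1 e2 wcc *.
have sx := pos_sa ax px.
have s1x : sa (1 + x) by apply: (saD ax) => //; exact: (sa1 ax).
have sy : st y = y.
  have h : st y * (1 + x) = 1 by rewrite -{1}s1x -(stM ax) e1 (st1 ax).
  by rewrite -[st y]mulr1 -e1 mulrA h mul1r.
have -> : y = st y * (1 + x) * y by rewrite sy e2 mul1r.
by apply: pos_conj; apply: (posD ax) => //; exact: (pos1 ax).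
Qed.

End StarSquares.

(** * The norm estimate for an abstract C*-algebra *)

Section MatchedBounds.
Context {R : realType} {B : pzRingType} {c : {rmorphism R[i] -> B}}.
Context {st : B -> B} {N : B -> R} (ax : cstar_axioms c st N).
Implicit Types (x y z : B) (t r : R).

Local Notation rc t := (c t%:C).
Local Notation sa := (@selfadj B st).
Local Notation pos := (@pos B st).
Local Notation comm := GRing.comm.

Lemma nrm_isom u x : st u * u = 1 -> N (u * x) = N x.
Proof.
move=> uu; apply/eqP; rewrite -(eqrXn2 (_ : 0 < 2)%N) ?(nrm_ge0 ax) //.
by rewrite -!(nrm_star ax) (stM ax) -mulrA [st u * _]mulrA uu mul1r.
Qed.

(* [K] plays the role of [2 Q - 1], [J] is the unitary part of its polar
   decomposition and [D] its modulus. *)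
Section Involution.
Variables (J D K : B).
Hypotheses (sJ : sa J) (JJ : J * J = 1) (pD : pos D) (KJD : K = J * D).
Hypotheses (KK : K * K = 1) (N1 : N 1 = 1).
Let s := N K.
Let D' := J * D * J.

Let sD : sa D. Proof. exact: (pos_sa ax). Qed.

Let stK' : st K = D * J. Proof. by rewrite KJD (stM ax) sJ sD. Qed.

Let pD' : pos D'.
Proof. by rewrite /D' -{1}sJ; exact: (pos_conj ax). Qed.

Let D'D : D' * D = 1. Proof. by rewrite /D' -mulrA -KJD KK. Qed.

Let DD' : D * D' = 1.
Proof.
have -> : D * D' = st (K * K) by rewrite (stM ax) stK' /D' !mulrA.
by rewrite KK (st1 ax).
Qed.

Let ND : N D = s.
Proof. by rewrite /s KJD nrm_isom // sJ. Qed.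

Let ND' : N D' = s.
Proof.
by rewrite /D' -mulrA nrm_isom ?sJ // -stK' (nrm_st ax).
Qed.

Let s_ge1 : 1 <= s.
Proof. by have := nrmM ax K K; rewrite KK N1 -/s; have := nrm_ge0 ax K; rewrite -/s; nra. Qed.

Let s' : R := s^-1.

Let sV : s * s' = 1.
Proof. by apply: divff; rewrite gt_eqF // (lt_le_trans ltr01). Qed.

(** The bound [E' <= s] passes to the inverse: the difference is [E * (s - E') / s], a product of
    commuting positive elements. *)
Let inv_ge E E' : pos E -> pos E' -> E * E' = 1 -> E' * E = 1 -> N E' = s ->
  pos (E - rc s').
Proof.
move=> pE pE' EE' E'E NE'.
have -> : E - rc s' = rc s' * (E * (rc s - E')).
  rewrite mulrBr EE' -(rcC ax) mulrBr mulrA -rcM mulrC sV rc1 mul1r mulr1 //.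
apply: (pos_rcM ax); first by rewrite invr_ge0 (le_trans ler01).
apply: (posM ax) => //.
  by apply: commrB; [rewrite /comm (rcC ax)|rewrite /comm EE'].
by apply: (pos_scalB ax); [exact: (pos_sa ax)|rewrite NE'].
Qed.

Lemma nrm_modulusB1 : N (D - 1) = s - 1.
Proof.
apply: le_anti; apply/andP; split; last first.
  by have := nrmD ax (D - 1) 1; rewrite subrK N1 ND; lra.
apply: (nrm_le_scal ax); first by rewrite subr_ge0.
- by apply: (saB ax) => //; exact: (sa1 ax).
- have -> : rc (s - 1) - (D - 1) = rc s - D by rewrite rcB rc1; ncring.
  by apply: (pos_scalB ax) => //; rewrite ND.
have -> : rc (s - 1) + (D - 1) = (D - rc s') + rc (s - 2 + s').
  by rewrite !(rcD, rcN) rc1; ncring.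
apply: (posD ax); first exact: inv_ge DD' D'D ND'.
by apply: (pos_rc ax); have := s_ge1; have := sV; nra.
Qed.

(** For the lower bound, [K * K = 1] gives [st K * K = 1 + (st K - K) * K], whence
    [s ^ 2 <= 1 + N (K - st K) * s]. *)
Lemma nrm_skew_part : N (K - st K) * s = s ^+ 2 - 1.
Proof.
apply: le_anti; apply/andP; split.
- have -> : K - st K = J * (D - D').
    by rewrite mulrBr -KJD /D' !mulrA JJ mul1r stK'.
  rewrite nrm_isom ?sJ //.
  have h : N (D - D') <= s - s'.
    have sB E : pos E -> N E = s -> pos (rc s - E).
      by move=> pE NE; apply: (pos_scalB ax); [exact: (pos_sa ax)|rewrite NE].
    apply: (nrm_le_scal ax).
    - by have := s_ge1; have := sV; nra.
    - by apply: (saB ax) => //; exact: (pos_sa ax).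
    - have -> : rc (s - s') - (D - D') = (rc s - D) + (D' - rc s').
        by rewrite rcB; ncring.
      by apply: (posD ax); [exact: sB|exact: inv_ge D'D DD' ND].
    - have -> : rc (s - s') + (D - D') = (rc s - D') + (D - rc s').
        by rewrite rcB; ncring.
      by apply: (posD ax); [exact: sB|exact: inv_ge DD' D'D ND'].
  by have := s_ge1; have := sV; nra.
have -> : s ^+ 2 = N (1 + (st K - K) * K).
  by rewrite mulrBl KK addrC subrK (nrm_star ax).
have := nrmD ax 1 ((st K - K) * K); have := nrmM ax (st K - K) K.
by rewrite N1 (nrmBC ax) -/s; lra.
Qed.

End Involution.

(* The projection is [Q Q* (1 + (Q - Q* ) (Q* - Q))^-1]. *)
Lemma idempotent_range_projection Q : Q * Q = Q ->
  exists P, [/\ sa P, P * P = P, P * Q = Q & Q * P = P].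
Proof.
move=> QQ; set x := st (st Q - Q) * (st Q - Q).
have xE : x = Q * st Q + st Q * Q - Q - st Q.
  have QQs : st Q * st Q = st Q by rewrite -(stM ax) QQ.
  rewrite /x (stB ax) (stK ax).
  apply: (@eq_subr _ _ _ ((Q - Q * Q) + (st Q - st Q * st Q))).
    by rewrite QQ QQs !subrr addr0.
  by ncring.
have [w [pw w1 w2 wc]] := pos_inv1D ax (pos_stM ax (st Q - Q)).
rewrite -/x in w1 w2 wc.
have xQ : x * Q = Q * st Q * Q - Q.
  rewrite xE; apply: (@eq_subr _ _ _ (st Q * (Q * Q - Q) - (Q * Q - Q))).
    by rewrite QQ subrr mulr0 subr0.
  by ncring.
have Qx : Q * x = Q * st Q * Q - Q.
  rewrite xE; apply: (@eq_subr _ _ _ ((Q * Q - Q) * st Q - (Q * Q - Q))).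
    by rewrite QQ subrr mul0r subr0.
  by ncring.
have sx : sa x by exact: (sa_stM ax).
have Qw : comm Q w by apply: wc; rewrite /comm Qx xQ.
have Qsw : comm (st Q) w.
  by apply: wc; rewrite /comm -{1}sx -{2}sx -!(stM ax) xQ Qx.
have QQsw : Q * st Q * w = w * (Q * st Q).
  by apply: commr_sym; apply: commrM; exact: commr_sym.
have PQ : Q * st Q * w * Q = Q.
  rewrite -[_ * w * Q]mulrA -Qw mulrA -[RHS]mulr1 -w1 mulrA; congr (_ * _).
  by rewrite mulrDr mulr1 Qx addrC subrK.
exists (Q * st Q * w); split => //.
- by rewrite /selfadj !(stM ax) (stK ax) (pos_sa ax pw) QQsw.
- by rewrite !mulrA PQ.
- by rewrite !mulrA QQ.
Qed.

(** * The matrix formula read in one ring *)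

Section Corner.
(** [n] stands for [A], and [b], [beta], [gamma], [delta] for [B], [B^-1], [(B (B + 1))^-1],
    [(B + 1)^-1], all extended by zero; [P] is the unit of the corner in which the inverses are
    taken. *)
Variables (P Q b beta gamma delta m : B).
Let n := Q - P.
Hypotheses (sP : sa P) (PQ : P * Q = Q) (QP : Q * P = P).
Hypotheses (pb : pos b) (bP : b * P = b) (bb : b * b = n * st n + P).
Hypotheses (betab : beta * b = P) (bbeta : b * beta = P) (betaP : beta * P = beta).
Hypothesis gammab : gamma * (b * (b + P)) = P.
Hypotheses (gammaP : gamma * P = gamma).
Hypothesis deltaE : delta = gamma * b.
Hypothesis mE : m = rc 2^-1 *
  ((b + P) * beta + beta * n + (st n * beta + st n * gamma * n)).
Hypothesis n0 : n != 0.

Let PP : P * P = P.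
Proof. by rewrite -{2}QP mulrA PQ QP. Qed.

Let QQ : Q * Q = Q.
Proof. by rewrite -{2}PQ mulrA QP PQ. Qed.

Let Pn : P * n = n. Proof. by rewrite mulrBr PQ PP. Qed.

Let nP : n * P = 0. Proof. by rewrite mulrBl QP PP subrr. Qed.

Let nsP : st n * P = st n. Proof. by rewrite -{2}Pn (stM ax) sP. Qed.

Let Pns : P * st n = 0. Proof. by rewrite -sP -(stM ax) nP (st0 ax). Qed.

Let sb : sa b. Proof. exact: (pos_sa ax). Qed.

Let Pb : P * b = b.
Proof. by rewrite -[RHS]sb -[in RHS]bP (stM ax) sP sb. Qed.

Let sbeta : sa beta.
Proof.
have h : b * st beta = P by rewrite -{1}sb -(stM ax) betab.
rewrite /selfadj -{2}betaP -h mulrA betab.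
by rewrite -{1}betaP (stM ax) sP.
Qed.

Let Pbeta : P * beta = beta.
Proof. by rewrite -[RHS]sbeta -[in RHS]betaP (stM ax) sP sbeta. Qed.

Let deltaP : delta * P = delta. Proof. by rewrite deltaE -mulrA bP. Qed.

Let deltabP : delta * (b + P) = P. Proof. by rewrite deltaE -mulrA gammab. Qed.

(** Partial fractions: [1 / b = 1 / (b (b + 1)) + 1 / (b + 1)]. This trades the lower right block of
    the formula for terms in [beta] and [delta]. *)
Let betaE : beta = gamma + delta.
Proof.
have h : (gamma + delta) * b = P.
  by rewrite -[RHS]gammab mulrDl deltaE -mulrA mulrDr bP addrC -mulrDr.
have -> : gamma + delta = (gamma + delta) * P by rewrite mulrDl gammaP deltaP.
by rewrite -bbeta mulrA h Pbeta.
Qed.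

Let pbeta : pos beta.
Proof.
have -> : beta = st beta * b * beta by rewrite sbeta betab Pbeta.
exact: (pos_conj ax).
Qed.

(** [delta] is the compression by [P] of the two-sided inverse of [1 + b], which yields positivity
    and the inverse law on the other side. *)
Let pdelta_bPdelta : pos delta /\ (b + P) * delta = P.
Proof.
have [w [pw w1 w2 wc]] := pos_inv1D ax pb.
have Pw : P * w = w * P by apply: wc; rewrite /comm bP.
have h : (b + P) * w = P.
  by rewrite -{1}Pb -{2}[P]mulr1 -mulrDr addrC -mulrA w1 mulr1.
have -> : delta = st P * w * P.
  by rewrite sP -mulrA -Pw mulrA PP -[LHS]deltaP -[in LHS]h mulrA deltabP.
split; first exact: (pos_conj ax).
by rewrite sP Pw -mulrA PP mulrA h PP.
Qed.

Let sdelta : sa delta. Proof. by case: pdelta_bPdelta => /(pos_sa ax). Qed.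

Let nsn : n * st n = b * b - P. Proof. by rewrite bb addrK. Qed.

Let nsndelta : n * st n * delta = b - P.
Proof.
have [_ h] := pdelta_bPdelta.
have -> : n * st n = (b - P) * (b + P).
  rewrite nsn; apply: (@eq_subr _ _ _ (P * b - b * P + (P * P - P))).
    by rewrite Pb bP PP !subrr addr0.
  by ncring.
by rewrite -mulrA h mulrBl bP PP.
Qed.

(* [J = 2 m - 1] and [D = J K] split into the same two positive summands, with
   opposite signs; [delta] is the inverse of [b + P] in the corner of [P]. *)
Let X := st Q * beta * Q.
Let Y := 1 - P + st n * delta * n.
Let J := X - Y.
Let D := X + Y.
Let K := Q + Q - 1.

Let QE : Q = P + n. Proof. by rewrite addrC subrK. Qed.

Let sX : sa X.
Proof. by rewrite /selfadj /X !(stM ax) (stK ax) sbeta mulrA. Qed.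

Let sY : sa Y.
Proof.
by rewrite /selfadj /Y (stD ax) (stB ax) (st1 ax) sP !(stM ax) (stK ax) sdelta mulrA.
Qed.

(** As [b] is positive, this makes it the modulus of [st Q]. Likewise [XX] and [YY] make [X] and [Y]
    the moduli of [Q] and [1 - Q], the right-hand side of [YY] being [st (1 - Q) * (1 - Q)]. *)
Let QQs : Q * st Q = b * b.
Proof.
by rewrite bb QE (stD ax) sP mulrDl !mulrDr PP Pns nP addr0 add0r addrC.
Qed.

Let XX : X * X = st Q * Q.
Proof.
have -> : X * X = st Q * (beta * (Q * st Q) * beta) * Q by rewrite /X !mulrA.
by rewrite QQs [beta * (b * b)]mulrA betab Pb bbeta -mulrA PQ.
Qed.

Let nE : n * (1 - P) = n. Proof. by rewrite mulrBr mulr1 nP subr0. Qed.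

Let YY : Y * Y = 1 - P + st n * n.
Proof.
have -> : Y * Y = (1 - P) * (1 - P) + (1 - P) * st n * delta * n
   + st n * delta * (n * (1 - P)) + st n * (delta * (n * st n * delta)) * n.
  by rewrite /Y; ncring.
rewrite nE nsndelta.
apply: (@eq_subr _ _ _ ((P * P - P) - P * st n * (delta * n)
   + st n * (delta * (b + P) - P) * n + (st n * P - st n) * n
   + st n * (delta - delta * P) * n + st n * (delta - delta * P) * n)).
  by rewrite PP Pns deltabP nsP deltaP !(subrr, mulr0, mul0r, addr0).
by ncring.
Qed.

Let XY : X * Y = n + st n * n.
Proof.
have -> : X * Y = st Q * (beta * (Q * (1 - P) + Q * st n * delta * n)).
  by rewrite /X /Y; ncring.
have -> : Q * st n = n * st n by rewrite QE mulrDl Pns add0r.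
rewrite nsndelta mulrBr mulr1 QP -/n mulrBl Pn addrC subrK [beta * _]mulrA betab Pn.
by rewrite QE (stD ax) sP mulrDl Pn.
Qed.

Let YX : Y * X = st n + st n * n.
Proof. by rewrite -{1}sY -{1}sX -(stM ax) XY (stD ax) (stM ax) (stK ax). Qed.

Let sJ : sa J. Proof. exact: (saB ax). Qed.

(** Besides the two squares, [- (X * Y)] is [st Q * (1 - Q)] and [- (Y * X)] is [st (1 - Q) * Q];
    the four terms add up to [st 1 * 1]. *)
Let JJ : J * J = 1.
Proof.
have -> : J * J = X * X + Y * Y - X * Y - Y * X by rewrite /J; ncring.
rewrite XX YY XY YX QE (stD ax) sP.
apply: (@eq_subr _ _ _ ((P * P - P) + (P * n - n) + (st n * P - st n))).
  by rewrite PP Pn nsP !subrr !addr0.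
by ncring.
Qed.

(** Right multiplication by [Q] fixes [X] and kills [Y], so [2 Q - 1] changes the sign of [Y]
    only. *)
Let JK : J * K = D.
Proof.
have -> : J * K = st Q * beta * (Q * Q) - (Y * Q) + (st Q * beta * (Q * Q) - (Y * Q)) - X + Y.
  by rewrite /J /K /X; ncring.
have -> : Y * Q = 0.
  have nQ : n * Q = 0 by rewrite mulrBl QQ PQ subrr.
  by rewrite /Y mulrDl [(1 - P) * Q]mulrBl mul1r PQ subrr -[_ * n * Q]mulrA nQ mulr0 addr0.
by rewrite QQ subr0 -/X addrK.
Qed.

Let pD : pos D.
Proof.
apply: (posD ax); first exact: (pos_conj ax).
apply: (posD ax); last by apply: (pos_conj ax); case: pdelta_bPdelta.
exists (1 - P); first by apply: (saB ax) => //; exact: (sa1 ax).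
rewrite mulrBr mulr1 mulrBl mul1r PP subrr subr0 //.
Qed.

Let KJD : K = J * D. Proof. by rewrite -JK mulrA JJ mul1r. Qed.

Let KK : K * K = 1.
Proof.
apply: (@eq_subr _ _ _ ((Q * Q - Q) + (Q * Q - Q) + (Q * Q - Q) + (Q * Q - Q))).
  by rewrite QQ subrr !addr0.
by rewrite /K; ncring.
Qed.

Let Nn_gt0 : 0 < N n.
Proof.
rewrite lt_def (nrm_ge0 ax) andbT; apply: contra n0 => /eqP h.
by rewrite (nrm_eq0 ax h).
Qed.

Let N1 : N 1 = 1.
Proof.
apply: le_anti; rewrite (nrm1 ax) /=.
by have := nrmM ax 1 n; rewrite mul1r; have := Nn_gt0; nra.
Qed.

(** [st (n - st n) * (n - st n)] is block diagonal for [P], with blocks [n * st n] and [st n * n] of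
    norm [N n ^ 2]; conversely [n = P * (n - st n)]. *)
Let nrm_nB : N (n - st n) = N n.
Proof.
have nn : n * n = 0 by rewrite -{2}Pn mulrA nP mul0r.
have nsns : st n * st n = 0 by rewrite -(stM ax) nn (st0 ax).
apply: le_anti; apply/andP; split; last first.
  have h : N P <= 1.
    have := nrm_sq ax sP; rewrite PP; have := nrm_ge0 ax P; nra.
  have : N (P * (n - st n)) <= N P * N (n - st n) := nrmM ax _ _.
  rewrite mulrBr Pn Pns subr0; have := nrm_ge0 ax (n - st n); nra.
rewrite -(ler_pXn2r (_ : 0 < 2)%N) ?nnegrE ?(nrm_ge0 ax) // -(nrm_star ax).
have e : st (n - st n) * (n - st n) = st n * n + n * st n.
  rewrite (stB ax) (stK ax); apply: (@eq_subr _ _ _ (- (n * n) - st n * st n)).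
    by rewrite nn nsns subr0 oppr0.
  by ncring.
set a := N n; have sE : sa (1 - P) by apply: (saB ax) => //; exact: (sa1 ax).
apply: (nrm_pos_le ax); first exact: (pos_stM ax); last by rewrite exprn_ge0 ?(nrm_ge0 ax).
have p1 : pos (rc (a ^+ 2) - st n * n).
  by apply: (pos_scalB ax); [exact: (sa_stM ax)|rewrite (nrm_star ax)].
have p2 : pos (rc (a ^+ 2) - n * st n).
  apply: (pos_scalB ax); first by rewrite -{1}(stK ax n); exact: (sa_stM ax).
  by rewrite -{1}(stK ax n) (nrm_star ax) (nrm_st ax).
(* Each bound is compressed to the block where it is needed; the two compressed scalars add up to
   [a ^ 2]. *)
have := posD ax (pos_conj ax P p2) (pos_conj ax (1 - P) p1).
congr (pos _); rewrite e sP sE.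
set r := rc (a ^+ 2); have rP : P * r = r * P by rewrite [RHS](rcC ax).
apply: (@eq_subr _ _ _ ((P * r - r * P) * P + (P * r - r * P) * P - (P * r - r * P)
   + (r * (P * P - P)) + (r * (P * P - P)) - (P * n * (st n * P) - n * st n)
   + P * st n * n * (1 - P) + st n * (n * P))).
  rewrite rP PP Pn nsP Pns nP !(subrr, mul0r, mulr0, oppr0, addr0) //.
by ncring.
Qed.

Lemma matched_norm_bounds : 2^-1 * N n < N (m - Q) /\ N (m - Q) < N n.
Proof.
have JE : J = (b + P) * beta + beta * n + (st n * beta + st n * gamma * n) - 1.
  have -> : gamma = beta - delta by rewrite betaE addrK.
  rewrite /J /X /Y {1 2}QE (stD ax) sP.
  apply: (@eq_subr _ _ _ (P * (beta * P - beta) + (P * beta - beta) * n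
      + st n * (beta * P - beta) + (P - b * beta))).
    by rewrite betaP Pbeta bbeta !subrr !(mulr0, mul0r) !addr0.
  by ncring.
have e : m - Q = rc 2^-1 * (J * (1 - D)).
  have -> : J * (1 - D) = J + 1 - (Q + Q) by rewrite mulrBr mulr1 -KJD /K; ncring.
  rewrite JE subrK mulrBr -mE; congr (_ - _).
  by rewrite mulrDr -mulrDl half2 mul1r.
have h1 : N (m - Q) = 2^-1 * (N K - 1).
  rewrite e (nrmr ax) nrm_isom ?sJ // (nrmBC ax) (@nrm_modulusB1 J D K) //.
  by rewrite ger0_norm //; lra.
have h2 : 2 * N n * N K = N K ^+ 2 - 1.
  rewrite -(@nrm_skew_part J D K) //; congr (_ * _).
  have -> : K - st K = rc 2 * (n - st n).
    have -> : rc 2 = 1 + 1 by rewrite (_ : 2 = 1 + 1) // rcD rc1.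
    rewrite /K QE (stB ax) (st1 ax) (stD ax (P + n)) (stD ax P) sP; ncring.
  by rewrite (nrmr ax) ger0_norm // nrm_nB.
have K1 : 1 <= N K.
  by have := nrmM ax K K; rewrite KK N1; have := nrm_ge0 ax K; nra.
(* With [s = N K] and [a = N n], [h2] gives [(s - 1) / 2 = a * s / (s + 1)]; as [a > 0] forces
   [s > 1], the factor [s / (s + 1)] lies strictly between [1 / 2] and [1]. *)
have := Nn_gt0; rewrite h1; split; nra.
Qed.

End Corner.
End MatchedBounds.

(** * Adjointable operators on a Hilbert module *)

Section CsNorm.
Context {R : realType} {A : cstarAlgebra R}.
Implicit Types a b : A.

Lemma normr_cs_norm a : `|a| = (cs_norm a)%:C.
Proof. by rewrite /cs_norm RRe_real // normr_real. Qed.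

Lemma cs_norm_ge0 a : 0 <= cs_norm a.
Proof. by rewrite -ler0c -normr_cs_norm. Qed.

Lemma cs_normD a b : cs_norm (a + b) <= cs_norm a + cs_norm b.
Proof. by rewrite -lecR rmorphD /= -!normr_cs_norm ler_normD. Qed.

Lemma cs_normM a b : cs_norm (cs_mul a b) <= cs_norm a * cs_norm b.
Proof. by rewrite -lecR rmorphM /= -!normr_cs_norm cs_normM. Qed.

Lemma cs_normZ k a : cs_norm (k *: a) = complex.Re `|k| * cs_norm a.
Proof.
apply: (@complexI R).
have -> : (complex.Re `|k| * cs_norm a)%:C = (complex.Re `|k|)%:C * (cs_norm a)%:C.
  by rewrite rmorphM.
by rewrite RRe_real ?normr_real // -!normr_cs_norm normrZ.
Qed.

Lemma cs_norm0 : cs_norm (0 : A) = 0.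
Proof. by rewrite /cs_norm normr0. Qed.

Lemma cs_norm_eq0 a : cs_norm a = 0 -> a = 0.
Proof. by move=> h; apply/eqP; rewrite -normr_eq0 normr_cs_norm h. Qed.

Lemma cs_normN a : cs_norm (- a) = cs_norm a.
Proof. by rewrite /cs_norm normrN. Qed.

Lemma cs_norm_double a : cs_norm (a + a) = cs_norm a *+ 2.
Proof.
have -> : a + a = (2%:R : R[i]) *: a by rewrite scaler_nat mulr2n.
by rewrite cs_normZ normr_nat -(rmorph_nat (real_complex R)) /= mulr_natl.
Qed.

Lemma cs_norm_cstar a : cs_norm (cs_mul (cs_star a) a) = cs_norm a ^+ 2.
Proof. by apply: (@complexI R); rewrite rmorphXn /= -!normr_cs_norm cs_cstar. Qed.

Lemma cs_norm_star a : cs_norm (cs_star a) = cs_norm a.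
Proof.
have h b : cs_norm b <= cs_norm (cs_star b).
  have := cs_norm_cstar b; have := cs_normM (cs_star b) b.
  have := cs_norm_ge0 b; have := cs_norm_ge0 (cs_star b); nra.
by apply: le_anti; rewrite h -{2}(cs_starK a) h.
Qed.

End CsNorm.

Section IpNorm.
Context {R : realType} {A : cstarAlgebra R} {E : ipModule A}.
Implicit Types x y z : E.

Lemma ip_norm_ge0 x : 0 <= ip_norm x.
Proof. exact: sqrtr_ge0. Qed.

Lemma ip_norm_sqr x : ip_norm x ^+ 2 = cs_norm (inner x x).
Proof. by rewrite sqr_sqrtr // cs_norm_ge0. Qed.

Lemma ip_norm0 : ip_norm (0 : E) = 0.
Proof. by rewrite /ip_norm inner0 cs_norm0 sqrtr0. Qed.

Lemma ip_norm_eq0 x : ip_norm x = 0 -> x = 0.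
Proof.
move=> h; apply: inner_eq0; apply: cs_norm_eq0.
by rewrite -ip_norm_sqr h expr0n.
Qed.

Lemma ip_normZ k x : ip_norm (k *: x) = complex.Re `|k| * ip_norm x.
Proof.
have k0 : 0 <= complex.Re `|k| by rewrite -ler0c RRe_real // normr_real.
rewrite /ip_norm innerZ innerZl !cs_normZ.
rewrite normcJ mulrA -expr2 sqrtrM ?exprn_ge0 // sqrtr_sqr ger0_norm //.
Qed.

Lemma ip_normZr (r : R) x : ip_norm (r%:C *: x) = `|r| * ip_norm x.
Proof. by rewrite ip_normZ normc_def /= expr0n addr0 sqrtr_sqr. Qed.

Lemma ip_normN x : ip_norm (- x) = ip_norm x.
Proof. by rewrite -scaleN1r ip_normZ normrN normr1 /= mul1r. Qed.

Lemma innerB x y z : inner x (y - z) = inner x y - inner x z.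
Proof. by rewrite innerD -scaleN1r innerZ scaleN1r. Qed.

Lemma innerBl x y z : inner (x - y) z = inner x z - inner y z.
Proof. by rewrite innerDl -scaleN1r innerZl rmorphN rmorph1 scaleN1r. Qed.

Lemma ip_normBC x y : ip_norm (x - y) = ip_norm (y - x).
Proof. by rewrite -ip_normN opprB. Qed.

End IpNorm.

(** A hypothesis of the operator theory below, which is applied to the coefficient algebra in order
    to prove it for every module. *)
Definition cauchy_schwarz (R : realType) (A : cstarAlgebra R) (E : ipModule A) :=
  forall x y : E, cs_norm (inner x y) <= ip_norm x * ip_norm y.

(** * Boundedness of adjointable operators *)

Section Bounded.
Context {R : realType} {A : cstarAlgebra R} {E : ipModule A}.
Hypotheses (CS : cauchy_schwarz E) (Ecomplete : ip_complete E).
Implicit Types (x y : E) (T S : linop E E).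

Lemma ip_normD x y : ip_norm (x + y) <= ip_norm x + ip_norm y.
Proof.
rewrite -(ler_pXn2r (_ : 0 < 2)%N) ?nnegrE ?addr_ge0 ?ip_norm_ge0 //.
rewrite ip_norm_sqr innerD !innerDl.
have := cs_normD (inner x x + inner y x) (inner x y + inner y y).
have := cs_normD (inner x x) (inner y x); have := cs_normD (inner x y) (inner y y).
by have := CS x y; have := CS y x; rewrite -!ip_norm_sqr; nra.
Qed.

Lemma ip_normB x y : ip_norm (x - y) <= ip_norm x + ip_norm y.
Proof. by rewrite -(ip_normN y) ip_normD. Qed.

(* Either [y + e z] or [y - e z] works, [z] being [w] normalized. *)
Lemma inner_large_nearby w y (e : R) : 0 <= e -> exists y',
  ip_norm (y' - y) <= e /\ e * ip_norm w <= cs_norm (inner w y').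
Proof.
move=> e0; have [/ip_norm_eq0 -> |w0] := eqVneq (ip_norm w) 0.
  by exists y; rewrite subrr !ip_norm0 mulr0 cs_norm_ge0.
have wp : 0 < ip_norm w by rewrite lt_def w0 ip_norm_ge0.
pose t := e / ip_norm w; pose z := t%:C *: w.
have t0 : 0 <= t by rewrite divr_ge0 // ip_norm_ge0.
have nz : ip_norm z = e.
  by rewrite ip_normZr ger0_norm // /t divfK.
have ewz : cs_norm (inner w z) = e * ip_norm w.
  rewrite innerZ cs_normZ normc_def /= expr0n addr0 sqrtr_sqr ger0_norm //.
  by rewrite -ip_norm_sqr /t expr2 mulrA divfK.
have main : cs_norm (inner w z) *+ 2 <=
    cs_norm (inner w (y + z)) + cs_norm (inner w (y - z)).
  have -> : cs_norm (inner w z) *+ 2 = cs_norm (inner w (y + z) - inner w (y - z)).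
    by rewrite -innerB opprB addrC addrA subrK innerD cs_norm_double.
  by rewrite -[cs_norm (inner w (y - z))]cs_normN; exact: cs_normD.
case: (lerP (cs_norm (inner w z)) (cs_norm (inner w (y + z)))) => h.
  by exists (y + z); rewrite addrAC subrr add0r nz lexx -ewz.
exists (y - z); rewrite addrAC subrr add0r ip_normN nz lexx -ewz; split => //.
by move: main; rewrite mulr2n; lra.
Qed.

(* Gliding hump, as in Sokal's proof of the uniform boundedness theorem, for the
   functionals [y |-> <T u, y> = <u, T* y>] with [u] in the unit ball. *)
Lemma linop_bounded T : exists M, forall x, ip_norm x <= 1 -> ip_norm (T x) <= M.
Proof.
apply: contrapT => /forallNP hT.
have {hT} hu (n : nat) : exists u, ip_norm u <= 1 /\ 4 * 3 ^+ n * n%:R <= ip_norm (T u).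
  have := hT (4 * 3 ^+ n * n%:R); move=> /existsNP[u /not_implyP[u1 hu]].
  by exists u; split=> //; move/negP: hu; rewrite -ltNge => /ltW.
pose u n := sval (cid (hu n)).
have u1 n : ip_norm (u n) <= 1 by rewrite /u; case: cid => v [].
have uT n : 4 * 3 ^+ n * n%:R <= ip_norm (T (u n)) by rewrite /u; case: cid => v [].
pose e (n : nat) : R := (3 ^+ n)^-1.
have e3 n : 0 < 3 ^+ n :> R by rewrite exprn_gt0.
have e0 n : 0 < e n by rewrite invr_gt0.
pose step n y := sval (cid (inner_large_nearby (T (u n)) y (ltW (e0 n)))).
have [step1 step2] : (forall n y, ip_norm (step n y - y) <= e n) /\
    (forall n y, e n * ip_norm (T (u n)) <= cs_norm (inner (T (u n)) (step n y))).
  by split=> n y; rewrite /step; case: cid => ? [].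
pose y := fix y n := if n is n'.+1 then step n' (y n') else 0.
have eS n : e n = 3 * e n.+1.
  by rewrite /e exprS; have := e3 n; move=> h; field; lra.
have ymn n k : 2 * ip_norm (y (n + k)%N - y n) <= 3 * (e n - e (n + k)%N).
  elim: k => [|k IH]; first by rewrite addn0 !subrr ip_norm0 mulr0.
  have := ip_normD (y (n + k).+1 - y (n + k)%N) (y (n + k)%N - y n).
  rewrite addrA subrK addnS; have := step1 (n + k)%N (y (n + k)%N).
  by have := eS (n + k)%N; rewrite -/(y (n + k).+1); lra.
have ymn' n m : (n <= m)%N -> 2 * ip_norm (y m - y n) <= 3 * e n.
  by move=> /subnKC <-; have := ymn n (m - n)%N; have := e0 (n + (m - n))%N; lra.
have [l hl] : exists l, forall d : R, 0 < d -> exists N, forall n, (N <= n)%N ->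
    ip_norm (y n - l) < d.
  apply: Ecomplete => d d0.
  have [N hN] : exists N : nat, 3 * e N < d.
    have [N /andP[_ hN]] : exists N : nat, 0 <= 3 / d < N%:R.
      exists (Num.truncn (3 / d)).+1.
      by rewrite divr_ge0 ?(ltW d0) //= truncnS_gt.
    exists N; rewrite /e ltr_pdivrMr // mulrC -ltr_pdivrMr //.
    apply: (lt_le_trans hN); rewrite -natrX ler_nat.
    by apply: ltnW; exact: ltn_expl.
  exists N => m n Nm Nn.
  have := ip_normB (y m - y N) (y n - y N).
  rewrite opprB addrA subrK; have := ymn' _ _ Nm; have := ymn' _ _ Nn; lra.
(* The choice of [step n] makes [T (u n)] pair with [y n.+1] to at least [e n * t], where [t] is the
   norm of [T (u n)]. Later steps move [y] by at most [e n / 2] and [l] is reached up to [e n / 4],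
   so the pairing with [l] keeps a quarter; the factor [4] in [hu] makes that at least [n]. *)
have key n : n%:R <= ip_norm (adj T l).
  have h1 := step2 n (y n).
  have d0 : 0 < 4^-1 * e n by rewrite mulr_gt0.
  have [m hm] := hl _ d0.
  have h2 := hm (maxn m n.+1) (leq_maxl _ _).
  have h3 := ymn' _ _ (leq_maxr m n.+1).
  have h4 := ip_normB (y (maxn m n.+1) - l) (y (maxn m n.+1) - y n.+1).
  rewrite opprB addrC addrA subrK in h4.
  have h5 := CS (T (u n)) (y n.+1 - l).
  have h6 : cs_norm (inner (T (u n)) l) <= ip_norm (adj T l).
    rewrite adjP; apply: le_trans (CS _ _) _.
    by have := u1 n; have := ip_norm_ge0 (adj T l); nra.
  have h7 := cs_normD (inner (T (u n)) l) (inner (T (u n)) (y n.+1 - l)).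
  rewrite -innerD addrC subrK -/(y n.+1) in h7.
  have h8 := uT n; have h9 := eS n.
  have h10 : ip_norm (y n.+1 - l) <= 3 / 4 * e n by lra.
  set t := ip_norm (T (u n)) in h1 h5 h8 *.
  have h11 : t * ip_norm (y n.+1 - l) <= t * (3 / 4 * e n).
    by rewrite ler_wpM2l // ip_norm_ge0.
  have h12 : e n * t <= t * (3 / 4 * e n) + ip_norm (adj T l) by rewrite -/(y n.+1) in h1; lra.
  have h13 : n%:R <= 4^-1 * (e n * t).
    rewrite /e mulrCA ler_pdivlMl //; lra.
  lra.
have := key (Num.truncn (ip_norm (adj T l))).+1.
by rewrite leNgt truncnS_gt.
Qed.

End Bounded.

(** * The ring of adjointable operators *)

Section OperatorRing.
Context {R : realType} {A : cstarAlgebra R}.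

Lemma linop_ext (E F : ipModule A) (S T : linop E F) : (forall x, S x = T x) -> S = T.
Proof. by move=> h; apply: val_inj; apply/funext. Qed.

Section Eval.
Context {E F : ipModule A}.
Implicit Types (S T : linop E F) (x y : E).

Lemma linopDE S T x : (S + T) x = S x + T x. Proof. by []. Qed.
Lemma linopNE T x : (- T) x = - T x. Proof. by []. Qed.
Lemma linopZE k T x : (k *: T) x = k *: T x. Proof. by []. Qed.
Lemma linop0E x : (0 : linop E F) x = 0. Proof. by []. Qed.

Lemma linopD T x y : T (x + y) = T x + T y.
Proof. by rewrite -[x]scale1r linop_linear !scale1r. Qed.

Lemma linopZ T k x : T (k *: x) = k *: T x.
Proof. by rewrite -[k *: x]addr0 linop_linear linop0 addr0. Qed.

Lemma adj_uniq T (S : linop F E) : adjoint_of T S -> adj T = S.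
Proof.
move=> h; apply: linop_ext => y; apply: inner_inj => x.
by rewrite -adjP h.
Qed.

End Eval.

Lemma adjK (E F : ipModule A) (T : linop E F) : adj (adj T) = T.
Proof. by apply: adj_uniq => x y; rewrite -adjPr. Qed.

Lemma adjD (E F : ipModule A) (S T : linop E F) : adj (S + T) = adj S + adj T.
Proof. by apply: adj_uniq => x y; rewrite !linopDE innerDl innerD !adjP. Qed.

Lemma adjZ (E F : ipModule A) k (T : linop E F) : adj (k *: T) = k^* *: adj T.
Proof. by apply: adj_uniq => x y; rewrite !linopZE innerZl innerZ adjP. Qed.

Lemma adjB (E F : ipModule A) (S T : linop E F) : adj (S - T) = adj S - adj T.
Proof.
by rewrite adjD -[- T]scaleN1r adjZ rmorphN rmorph1 scaleN1r.
Qed.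

Lemma adj_comp (E F G : ipModule A) (S : linop F G) (T : linop E F) :
  adj (S *L T) = adj T *L adj S.
Proof. by apply: adj_uniq => x y /=; rewrite !adjP. Qed.

Lemma adj_lid (E : ipModule A) : adj (@lid R A E) = lid.
Proof. exact: adj_uniq. Qed.

Lemma lcompA (E F G K : ipModule A) (S : linop G K) (T : linop F G) (U : linop E F) :
  S *L (T *L U) = S *L T *L U.
Proof. exact: linop_ext. Qed.

Lemma lcomp1l (E F : ipModule A) (T : linop E F) : lid *L T = T.
Proof. exact: linop_ext. Qed.

Lemma lcomp1r (E F : ipModule A) (T : linop E F) : T *L lid = T.
Proof. exact: linop_ext. Qed.

Lemma lcompDl (E F G : ipModule A) (S T : linop F G) (U : linop E F) :
  (S + T) *L U = S *L U + T *L U.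
Proof. exact: linop_ext. Qed.

Lemma lcompDr (E F G : ipModule A) (S : linop F G) (T U : linop E F) :
  S *L (T + U) = S *L T + S *L U.
Proof. by apply: linop_ext => x /=; rewrite linopD. Qed.

Section Ring.
Variable E : ipModule A.

HB.instance Definition _ := GRing.Zmodule_isPzRing.Build (linop E E)
  (@lcompA E E E E) (@lcomp1l E E) (@lcomp1r E E) (@lcompDl E E E) (@lcompDr E E E).

Definition lscal (k : R[i]) : linop E E := k *: lid.

Lemma lscal_is_additive : zmod_morphism lscal.
Proof. by move=> k l; rewrite /lscal scalerBl. Qed.

Lemma lscal_is_monoid : monoid_morphism lscal.
Proof.
split; first by rewrite /lscal scale1r.
by move=> k l; apply: linop_ext => x; exact: (esym (scalerA _ _ _)).
Qed.

HB.instance Definition _ := GRing.isZmodMorphism.Build R[i] (linop E E) lscal lscal_is_additive.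
HB.instance Definition _ := GRing.isMonoidMorphism.Build R[i] (linop E E) lscal lscal_is_monoid.

End Ring.
End OperatorRing.

(** * The operator norm as a complete C*-norm *)

Section OperatorNorm.
Context {R : realType} {A : cstarAlgebra R} {E : ipModule A}.
Hypotheses (CS : cauchy_schwarz E) (Ecomplete : ip_complete E).
Implicit Types (x y : E) (T S : linop E E).

Let unit_img T := [set ip_norm (T x) | x in [set x : E | ip_norm x <= 1]].

Let has_sup_unit_img T : has_sup (unit_img T).
Proof.
split; first by exists (ip_norm (T 0)), 0 => //=; rewrite ip_norm0.
by have [M hM] := linop_bounded CS Ecomplete T; exists M => _ [x x1 <-]; exact: hM.
Qed.

Lemma opnorm_ge0 T : 0 <= opnorm T.
Proof.
apply: (@le_trans _ _ (ip_norm (T 0))); first exact: ip_norm_ge0.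
apply: ub_le_sup; first by case: (has_sup_unit_img T).
by exists 0 => //=; rewrite ip_norm0.
Qed.

Lemma ip_norm_linop T x : ip_norm (T x) <= opnorm T * ip_norm x.
Proof.
have [/ip_norm_eq0 -> |x0] := eqVneq (ip_norm x) 0.
  by rewrite linop0 !ip_norm0 mulr0.
have xp : 0 < ip_norm x by rewrite lt_def x0 ip_norm_ge0.
rewrite -ler_pdivrMr //.
have i0 : 0 <= (ip_norm x)^-1 by rewrite invr_ge0 ltW.
apply: ub_le_sup; first by case: (has_sup_unit_img T).
exists ((ip_norm x)^-1%:C *: x) => /=.
  by rewrite ip_normZr ger0_norm // mulVf.
by rewrite linopZ ip_normZr ger0_norm // mulrC.
Qed.

Lemma opnorm_le T M : 0 <= M -> (forall x, ip_norm (T x) <= M * ip_norm x) ->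
  opnorm T <= M.
Proof.
move=> M0 hM; apply: ge_sup; first by case: (has_sup_unit_img T).
by move=> _ [x /= x1 <-]; apply: le_trans (hM x) _; rewrite ler_piMr.
Qed.

Lemma opnormD S T : opnorm (S + T) <= opnorm S + opnorm T.
Proof.
apply: opnorm_le => [|x]; first by rewrite addr_ge0 ?opnorm_ge0.
rewrite linopDE; apply: le_trans (ip_normD CS _ _) _.
by rewrite mulrDl lerD ?ip_norm_linop.
Qed.

Lemma opnorm_comp S T : opnorm (S *L T) <= opnorm S * opnorm T.
Proof.
apply: opnorm_le => [|x]; first by rewrite mulr_ge0 ?opnorm_ge0.
rewrite /= -mulrA; apply: le_trans (ip_norm_linop _ _) _.
by rewrite ler_wpM2l ?opnorm_ge0 ?ip_norm_linop.
Qed.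

Lemma opnorm0 : opnorm (0 : linop E E) = 0.
Proof.
apply: le_anti; rewrite opnorm_ge0 andbT; apply: opnorm_le => // x.
by rewrite linop0E ip_norm0 mul0r.
Qed.

Lemma opnorm_eq0 T : opnorm T = 0 -> T = 0.
Proof.
move=> T0; apply: linop_ext => x; apply: ip_norm_eq0; apply: le_anti.
by rewrite ip_norm_ge0 andbT; have := ip_norm_linop T x; rewrite T0 mul0r.
Qed.

Lemma opnormZ k T : opnorm (k *: T) = complex.Re `|k| * opnorm T.
Proof.
have h l S : opnorm (l *: S) <= complex.Re `|l| * opnorm S.
  have l0 : 0 <= complex.Re `|l| by rewrite -ler0c RRe_real // normr_real.
  apply: opnorm_le => [|x]; first by rewrite mulr_ge0 ?opnorm_ge0.
  by rewrite linopZE ip_normZ -mulrA ler_wpM2l // ip_norm_linop.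
have [-> |k0] := eqVneq k 0; first by rewrite scale0r normr0 opnorm0 mul0r.
apply: le_anti; rewrite h /=.
have := h k^-1 (k *: T); rewrite scalerA mulVf // scale1r normrV ?unitfE //.
have kp : 0 < complex.Re `|k|.
  by rewrite -ltcR RRe_real ?normr_real // normr_gt0.
have -> : complex.Re `|k|^-1 = (complex.Re `|k|)^-1.
  apply: (@complexI R).
  have -> : (complex.Re `|k|)^-1%:C = ((complex.Re `|k|)%:C)^-1 by rewrite fmorphV.
  by rewrite !RRe_real // ?realV normr_real.
by rewrite ler_pdivlMl.
Qed.

Lemma opnormN T : opnorm (- T) = opnorm T.
Proof. by rewrite -scaleN1r opnormZ normrN normr1 /= mul1r. Qed.

(** Cauchy-Schwarz applied to [<T x, T x> = <x, adj T (T x)>] gives one inequality; the same for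
    [adj T] gives [|adj T| <= |T|], and with it the other. *)
Lemma opnorm_cstar T : opnorm (adj T *L T) = opnorm T ^+ 2.
Proof.
have le1 S : opnorm S ^+ 2 <= opnorm (adj S *L S).
  have a0 := opnorm_ge0 (adj S *L S).
  rewrite -[leRHS]sqr_sqrtr // ler_pXn2r ?nnegrE ?opnorm_ge0 ?sqrtr_ge0 //.
  apply: opnorm_le => [|x]; first exact: sqrtr_ge0.
  rewrite -(ler_pXn2r (_ : 0 < 2)%N) ?nnegrE ?ip_norm_ge0 ?mulr_ge0 ?sqrtr_ge0 ?ip_norm_ge0 //.
  rewrite [leLHS]ip_norm_sqr exprMn [X in X * _]sqr_sqrtr // adjP.
  apply: le_trans (CS _ _) _; have := ip_norm_linop (adj S *L S) x.
  by have := ip_norm_ge0 x; rewrite /=; nra.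
have le2 S : opnorm (adj S) <= opnorm S.
  have := le1 (adj S); rewrite adjK; have := opnorm_comp S (adj S).
  have := opnorm_ge0 S; have := opnorm_ge0 (adj S); nra.
apply: le_anti; rewrite le1 andbT; apply: le_trans (opnorm_comp _ _) _.
by rewrite expr2 ler_wpM2r ?opnorm_ge0.
Qed.

Lemma opnorm_adj T : opnorm (adj T) = opnorm T.
Proof.
have h S : opnorm S <= opnorm (adj S).
  have := opnorm_cstar S; have := opnorm_comp (adj S) S.
  have := opnorm_ge0 S; have := opnorm_ge0 (adj S); nra.
by apply: le_anti; rewrite h -{2}(adjK T) h.
Qed.

(** A pointwise limit [f] alone is a bare function. The adjoints form a Cauchy sequence too, and
    their pointwise limit [g] is adjoint to [f], which puts [f] in [linop]. *)
Lemma opnorm_complete (u : nat -> linop E E) :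
  (forall e : R, 0 < e -> exists n0, forall m n, (n0 <= m)%N -> (n0 <= n)%N ->
     opnorm (u m - u n) < e) ->
  exists l, forall e : R, 0 < e -> exists n0, forall n, (n0 <= n)%N ->
     opnorm (u n - l) < e.
Proof.
have pointwise (v : nat -> linop E E) :
    (forall e : R, 0 < e -> exists n0, forall m n, (n0 <= m)%N -> (n0 <= n)%N ->
       opnorm (v m - v n) < e) ->
    exists f : E -> E, forall x (e : R), 0 < e -> exists n0, forall n, (n0 <= n)%N ->
       ip_norm (v n x - f x) < e.
  move=> hv; suff /choice[f hf] : forall x, exists l, forall e : R, 0 < e ->
      exists n0, forall n, (n0 <= n)%N -> ip_norm (v n x - l) < e by exists f.
  move=> x; apply: Ecomplete => e e0.
  have x1 : 0 < 1 + ip_norm x by rewrite ltr_wpDr ?ip_norm_ge0.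
  have [n0 hn0] := hv _ (divr_gt0 e0 x1); exists n0 => m n n0m n0n.
  have h := ip_norm_linop (v m - v n) x; apply: (le_lt_trans h).
  have := hn0 m n n0m n0n; rewrite ltr_pdivlMr //.
  have := opnorm_ge0 (v m - v n); have := ip_norm_ge0 x; nra.
move=> hu; have [f hf] := pointwise _ hu.
have [|g hg] := pointwise (fun n => adj (u n)).
  move=> e /hu[n0 hn0]; exists n0 => m n n0m n0n.
  by rewrite -adjB opnorm_adj hn0.
have fg : adjoint_of f g.
  move=> x y; apply/eqP; rewrite -subr_eq0; apply/eqP/cs_norm_eq0.
  apply: le_anti; rewrite cs_norm_ge0 andbT.
  apply/ler_addgt0Pr => e e0; rewrite add0r.
  pose M := 1 + ip_norm x + ip_norm y.
  have M0 : 0 < M by rewrite /M; have := ip_norm_ge0 x; have := ip_norm_ge0 y; lra.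
  have [n1 h1] := hf x _ (divr_gt0 e0 M0); have [n2 h2] := hg y _ (divr_gt0 e0 M0).
  have {}h1 := h1 _ (leq_maxl n1 n2); have {}h2 := h2 _ (leq_maxr n1 n2).
  set n := maxn n1 n2 in h1 h2.
  have -> : inner (f x) y - inner x (g y) =
      inner (f x - u n x) y + inner x (adj (u n) y - g y).
    by rewrite innerB -adjP innerBl subrKA.
  apply: le_trans (cs_normD _ _) _.
  have := CS (f x - u n x) y; have := CS x (adj (u n) y - g y).
  rewrite [ip_norm (f x - _)]ip_normBC.
  move: h1 h2; rewrite !ltr_pdivlMr // /M.
  have := ip_norm_ge0 x; have := ip_norm_ge0 y.
  have := ip_norm_ge0 (u n x - f x); have := ip_norm_ge0 (adj (u n) y - g y).
  nra.
have fl : f \in @adjointable R A E E by rewrite inE; exists g.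
exists (Linop fl) => e e0.
have e20 : 0 < e / 2 by lra.
have [n0 hn0] := hu _ e20; exists n0 => n n0n.
apply: (@le_lt_trans _ _ (e / 2)); last by lra.
apply: opnorm_le => [|x]; first exact: ltW.
(* The index [n1] depends on [x] but affects only the arbitrary error [d], so the bound by [e / 2]
   is uniform in [x]. *)
apply/ler_addgt0Pr => d d0.
have [n1 hn1] := hf x _ d0.
have h1 := hn1 _ (leq_maxr n0 n1); have h2 := hn0 _ _ n0n (leq_maxl n0 n1).
have -> : (u n - Linop fl) x = (u n - u (maxn n0 n1)) x + (u (maxn n0 n1) x - f x).
  by rewrite !linopDE !linopNE /= addrA subrK.
apply: le_trans (ip_normD CS _ _) _.
apply: lerD; last exact: ltW.
apply: le_trans (ip_norm_linop _ _) _.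
by rewrite ler_wpM2r ?ip_norm_ge0 // ltW.
Qed.

Lemma linop_cstar : cstar_axioms (lscal E) (@adj R A E E) (@opnorm R A E E).
Proof.
split.
- by move=> k T; apply: linop_ext => x; rewrite /= linopZ.
- exact: adjD.
- exact: adj_comp.
- exact: adjK.
- by move=> k; rewrite /lscal /= adjZ adj_lid.
- exact: opnormD.
- exact: opnorm_comp.
- move=> k T; rewrite -opnormZ; congr opnorm; exact: linop_ext.
- exact: opnorm_cstar.
- exact: opnorm_eq0.
- exact: opnorm_complete.
Qed.

End OperatorNorm.

(** * Left multiplications and Cauchy-Schwarz *)

Section CauchySchwarz.
Context {R : realType} {A : cstarAlgebra R}.

(** The algebra as a right module over itself; its adjointable operators form a unital algebra into
    which [lmul] embeds it isometrically. *)
Definition alg_mod : ipModule A.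
Proof.
refine (@IpModule R A (cs_car A) (@cs_mul R A)
  (fun a b => cs_mul (cs_star a) b) _ _ _ _ _ _ _ _ _ _ _).
- exact: cs_mulDl.
- exact: cs_mulDr.
- by move=> x a b; rewrite cs_mulA.
- by move=> k x a; rewrite cs_scalel.
- by move=> k x a; rewrite cs_scaler.
- by move=> x y z; rewrite cs_mulDr.
- by move=> k x y; rewrite cs_scaler.
- by move=> x y a; rewrite cs_mulA.
- by move=> x y; rewrite cs_starM cs_starK.
- by move=> x; exists x.
- move=> x x0; apply: cs_norm_eq0; have := cs_norm_cstar x; rewrite x0 cs_norm0.
  by move/esym/eqP; rewrite expf_eq0 => /eqP.
Defined.

Lemma ip_norm_alg (a : alg_mod) : ip_norm a = cs_norm (a : A).
Proof. by rewrite /ip_norm /= cs_norm_cstar sqrtr_sqr ger0_norm // cs_norm_ge0. Qed.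

Lemma alg_mod_CS : cauchy_schwarz alg_mod.
Proof.
by move=> a b; rewrite !ip_norm_alg -(cs_norm_star (a : A)); exact: cs_normM.
Qed.

Lemma alg_mod_complete : ip_complete alg_mod.
Proof.
move=> u hu; pose v : nat -> A := u.
have cv : cvgn v.
  apply/cauchy_cvgP; apply: cauchy_exP => e e0.
  have e1 : e = (complex.Re e)%:C by rewrite RRe_real // gtr0_real.
  have [n0 hn0] : exists N : nat, forall m n : nat, (N <= m)%N -> (N <= n)%N ->
      ip_norm (u m - u n) < complex.Re e.
    by apply: hu; rewrite -ltcR -e1.
  exists (v n0), n0 => // n /= n0n; rewrite -ball_normE /= e1 normr_cs_norm ltcR.
  by rewrite -[cs_norm _]ip_norm_alg; exact: hn0.
exists (limn v) => e e0.
have ec0 : 0 < e%:C by rewrite -[0]/((0 : R)%:C) ltcR.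
have /cvgrPdist_lt/(_ _ ec0)[n0 _ hn0] := cv.
exists n0 => n n0n; rewrite ip_norm_alg -ltcR -normr_cs_norm distrC.
exact: hn0.
Qed.

Lemma lmul_adjointable (a : A) :
  (cs_mul a : alg_mod -> alg_mod) \in @adjointable R A alg_mod alg_mod.
Proof.
rewrite inE; exists (cs_mul (cs_star a)) => x y /=.
by rewrite cs_starM cs_mulA.
Qed.

Definition lmul (a : A) : linop alg_mod alg_mod := Linop (lmul_adjointable a).

Let ax := linop_cstar alg_mod_CS alg_mod_complete.

Lemma lmulM a b : lmul (cs_mul a b) = lmul a * lmul b.
Proof. by apply: linop_ext => x /=; rewrite cs_mulA. Qed.

Lemma lmulD a b : lmul (a + b) = lmul a + lmul b.
Proof. by apply: linop_ext => x /=; rewrite cs_mulDl. Qed.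

Lemma lmulZ k a : lmul (k *: a) = lscal alg_mod k * lmul a.
Proof. by apply: linop_ext => x /=; rewrite cs_scalel. Qed.

Lemma lmul_star a : lmul (cs_star a) = adj (lmul a).
Proof.
apply/esym/adj_uniq => x y /=.
by rewrite cs_starM cs_mulA.
Qed.

(** By the C*-identity the norm is reached in the direction of [cs_star a]. *)
Lemma opnorm_lmul a : opnorm (lmul a) = cs_norm a.
Proof.
apply: le_anti; apply/andP; split.
  apply: (opnorm_le alg_mod_CS alg_mod_complete) => [|x]; first exact: cs_norm_ge0.
  by rewrite !ip_norm_alg; exact: cs_normM.
have := ip_norm_linop alg_mod_CS alg_mod_complete (lmul a) (cs_star a : alg_mod).
rewrite !ip_norm_alg /= -{1}(cs_starK a) cs_norm_cstar cs_norm_star.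
have := cs_norm_ge0 a; have := nrm_ge0 ax (lmul a); nra.
Qed.

Lemma pos_lmul (a : A) : cs_pos a -> @pos _ adj (lmul a).
Proof. by case=> b ->; rewrite lmulM lmul_star; exact: (pos_stM ax). Qed.

Local Notation rc t := (lscal alg_mod t%:C).

(* With [p = <x, x>], [q = <x, y>] and [t = |p|], expanding [<z, z> >= 0] for
   [z = x q - t y] gives [t^2 <y, y> >= q* q t + q* (t - p) q]. *)
Lemma ip_cauchy_schwarz (E : ipModule A) : cauchy_schwarz E.
Proof.
move=> x y; set p := inner x x; set q := inner x y; set s := inner y y.
set t := cs_norm p.
have tE : t = ip_norm x ^+ 2 by rewrite ip_norm_sqr.
have sE : cs_norm s = ip_norm y ^+ 2 by rewrite ip_norm_sqr.
have [x0|xn0] := eqVneq (ip_norm x) 0.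
  rewrite x0 mul0r /q (ip_norm_eq0 x0) inner0l cs_norm0 //.
have xp : 0 < ip_norm x by rewrite lt_def xn0 ip_norm_ge0.
have t0 : 0 < t by rewrite tE exprn_gt0.
pose z := ip_act x q - t%:C *: y.
have zz : rc (t ^+ 2) * lmul s =
   rc t * lmul (cs_mul (cs_star q) q) +
   (lmul (inner z z) + adj (lmul q) * (rc t - lmul p) * lmul q).
  have aE : inner x (ip_act x q) = cs_mul p q by rewrite innerA.
  have aE' : inner (ip_act x q) x = cs_mul (cs_star q) p.
    by rewrite -inner_star aE cs_starM [cs_star p]inner_star.
  have bE : inner y (ip_act x q) = cs_mul (cs_star q) q.
    by rewrite innerA -[inner y x]inner_star.
  have bE' : inner (ip_act x q) y = cs_mul (cs_star q) q.
    by rewrite -inner_star bE cs_starM cs_starK.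
  have aaE : inner (ip_act x q) (ip_act x q) = cs_mul (cs_mul (cs_star q) p) q.
    by rewrite innerA aE'.
  have lN a : lmul (- a) = - lmul a.
    by apply: linop_ext => w /=; rewrite -scaleN1r cs_scalel scaleN1r.
  have -> : inner z z = cs_mul (cs_mul (cs_star q) p) q
      - t%:C *: cs_mul (cs_star q) q
      - (t%:C *: (cs_mul (cs_star q) q - t%:C *: s)).
    have tt : ((t%:C)^*)%R = t%:C :> R[i] by exact: conjc_real.
    by rewrite /z innerB innerZ !innerBl !innerZl tt aaE bE bE'.
  rewrite !(lmulD, lN, lmulZ, lmulM, lmul_star).
  rewrite (_ : rc (t ^+ 2) = rc t * rc t); last first.
    by rewrite -rmorphM expr2; congr lscal; rewrite rmorphM.
  set a := rc t; set b := lmul q; set d := adj b.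
  have ab w : a * w = w * a by exact: (rcC ax).
  apply: (@eq_subr _ _ _ ((a * d - d * a) * b)); first by rewrite ab subrr mul0r.
  by ncring.
have pq : @pos _ adj (lmul (cs_mul (cs_star q) q)) by apply: pos_lmul; exists q.
have h : opnorm (rc t * lmul (cs_mul (cs_star q) q)) <= opnorm (rc (t ^+ 2) * lmul s).
  rewrite zz; apply: (nrm_posD ax).
    by apply: (pos_rcM ax) => //; exact: ltW.
  apply: (posD ax); first by apply: pos_lmul; exact: inner_pos.
  apply: (pos_conj ax); apply: (pos_scalB ax); last by rewrite opnorm_lmul.
  by apply: (pos_sa ax); apply: pos_lmul; exact: inner_pos.
move: h; rewrite !(nrmr ax) !opnorm_lmul cs_norm_cstar sE.
rewrite (ger0_norm (ltW t0)) (ger0_norm (exprn_ge0 2 (ltW t0))).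
rewrite [t ^+ 2]expr2 -mulrA ler_pM2l // tE -exprMn.
by rewrite ler_pXn2r ?nnegrE ?mulr_ge0 ?ip_norm_ge0 ?cs_norm_ge0.
Qed.

End CauchySchwarz.

(** * The matched projection *)

Section ToLinop.
Context {R : realType} {A : cstarAlgebra R}.

Lemma to_linop_eq (E F : ipModule A) (f : E -> F) (T : linop E F) :
  (forall x, f x = T x) -> to_linop f = T.
Proof.
move=> /funext ->; exact: (valKd (0 : linop E F) T).
Qed.

Lemma val_to_sub (E : ipModule A) (S : submodule E) x :
  sub_set S x -> \val (to_sub S x) = x.
Proof. by move=> h; apply: insubdK; rewrite inE. Qed.

Context {E : ipModule A} {S : submodule E} {P : linop E E}.
Hypotheses (sP : adj P = P) (PS : forall x, sub_set S (P x)).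
Hypothesis SP : forall x, sub_set S x -> P x = x.

(** The corestriction of the projection [P] to its range [S]. Its adjoint is the inclusion, so it is
    a coisometry; [matched_U1] and [matched_U2] arise from the range projection and its
    complement. *)
Let proj : linop E (sub_ip S) := to_linop (fun h => to_sub S (P h)).

Let incl_adjoint : adjoint_of (fun h => to_sub S (P h)) (fun y : sub_ip S => \val y).
Proof.
move=> x y; change (inner (\val (to_sub S (P x))) (\val y) = inner x (\val y)).
by rewrite val_to_sub // adjP sP SP //; apply: set_mem; exact: valP.
Qed.

Lemma val_proj h : \val (proj h) = P h.
Proof.
rewrite /proj /to_linop insubdK ?val_to_sub //.
by rewrite inE; exists (fun y : sub_ip S => \val y); exact: incl_adjoint.
Qed.

Lemma adj_proj y : adj proj y = \val y.
Proof.
apply: inner_inj => x; rewrite -adjP.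
change (inner (\val (proj x)) (\val y) = inner x (\val y)).
by rewrite val_proj adjP sP SP //; apply: set_mem; exact: valP.
Qed.

Lemma proj_adj_proj : proj *L adj proj = lid.
Proof.
apply: linop_ext => y; apply: val_inj; change (\val (proj (adj proj y)) = \val y).
rewrite val_proj adj_proj SP //.
by apply: set_mem; exact: valP.
Qed.

Lemma adj_proj_proj : adj proj *L proj = P.
Proof.
apply: linop_ext => x; change (adj proj (proj x) = P x).
by rewrite adj_proj val_proj.
Qed.

End ToLinop.

Section OpSpecs.
Context {R : realType} {A : cstarAlgebra R} {E : ipModule A}.
Implicit Types S T : linop E E.

(** [op_sqrt] picks a root by choice: a witness secures the defining property of whichever root was
    picked. *)
Lemma op_sqrtP S T : op_pos S -> S *L S = T ->
  op_pos (op_sqrt T) /\ op_sqrt T *L op_sqrt T = T.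
Proof.
move=> pS ST; apply: (@xgetPex _ 0 [set S' | op_pos S' /\ S' *L S' = T]).
by exists S.
Qed.

Lemma op_invP S T : S *L T = lid -> T *L S = lid ->
  op_inv T *L T = lid /\ T *L op_inv T = lid.
Proof.
move=> ST TS; apply: (@xgetPex _ 0 [set S' | S' *L T = lid /\ T *L S' = lid]).
by exists S.
Qed.

Lemma range_projP P T : is_idempotent T -> is_projection P -> P *L T = T -> T *L P = P ->
  [/\ is_projection (range_proj T), range_proj T *L T = T & T *L range_proj T = range_proj T].
Proof.
move=> TT pP PT TP.
have [] : is_projection (range_proj T) /\ range (range_proj T) = range T.
  apply: (@xgetPex _ 0 [set P' | is_projection P' /\ range P' = range T]).
  exists P; split=> //; apply/seteqP; split=> _ [x _ <-].
    by exists (P x) => //; exact: (congr1 (fun S : linop E E => S x) TP).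
  by exists (T x) => //; exact: (congr1 (fun S : linop E E => S x) PT).
set P' := range_proj T; move=> [PP' sP'] rP'; split=> //.
- apply: linop_ext => x /=; have : range T (T x) by exists x.
  rewrite -rP' => -[y _ <-]; exact: (congr1 (fun S : linop E E => S y) PP').
- apply: linop_ext => x /=; have : range P' (P' x) by exists x.
  rewrite rP' => -[y _ <-]; exact: (congr1 (fun S : linop E E => S y) TT).
Qed.

End OpSpecs.

(** * Compression to a submodule and expansion to a corner *)

Section Compression.
Context {R : realType} {A : cstarAlgebra R} {H E : ipModule A}.
Variable U : linop H E.
Hypothesis UU : U *L adj U = lid.
Let P : linop H H := adj U *L U.

(** [expand] identifies [L(E)] with the corner of [P], a ring with unit [P], and [compress] is a
    left inverse of it, multiplicative when the left factor commutes with [P]. *)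
Definition compress (X : linop H H) : linop E E := U *L X *L adj U.
Definition expand (Y : linop E E) : linop H H := adj U *L Y *L U.

Lemma compress1 : compress 1 = 1.
Proof. by rewrite /compress -[1]/lid lcomp1r UU. Qed.

Lemma compressD X Y : compress (X + Y) = compress X + compress Y.
Proof. by rewrite /compress lcompDr lcompDl. Qed.

Lemma compressM X Y : P * X = X * P -> compress X * compress Y = compress (X * Y).
Proof.
move=> PX; change (U *L X *L adj U *L (U *L Y *L adj U) = U *L (X *L Y) *L adj U).
have PX' : adj U *L U *L X = X *L (adj U *L U) by exact: PX.
rewrite !lcompA -(lcompA _ (adj U) U) -(lcompA U X) -PX' !lcompA UU.
by rewrite lcomp1l.
Qed.

Lemma compressK Y : compress (expand Y) = Y.
Proof. by rewrite /compress /expand !lcompA UU lcomp1l -lcompA UU lcomp1r. Qed.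

Lemma expand_compress X : expand (compress X) = P * X * P.
Proof.
change (adj U *L (U *L X *L adj U) *L U = adj U *L U *L X *L (adj U *L U)).
by rewrite !lcompA.
Qed.

Lemma expand1 : expand 1 = P.
Proof. by rewrite /expand -[1]/lid lcomp1r. Qed.

Lemma expandD X Y : expand (X + Y) = expand X + expand Y.
Proof. by rewrite /expand lcompDr lcompDl. Qed.

Lemma expandM X Y : expand (X * Y) = expand X * expand Y.
Proof.
change (adj U *L (X *L Y) *L U = adj U *L X *L U *L (adj U *L Y *L U)).
by rewrite !lcompA -(lcompA _ U (adj U)) UU lcomp1r.
Qed.

Lemma adj_compress X : adj (compress X) = compress (adj X).
Proof. by rewrite /compress !adj_comp adjK lcompA. Qed.

Lemma adj_expand Y : adj (expand Y) = expand (adj Y).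
Proof. by rewrite /expand !adj_comp adjK lcompA. Qed.

Lemma expandP Y : expand Y * P = expand Y.
Proof.
change (adj U *L Y *L U *L (adj U *L U) = adj U *L Y *L U).
by rewrite lcompA -(lcompA _ U (adj U)) UU lcomp1r.
Qed.

Lemma Pexpand Y : P * expand Y = expand Y.
Proof.
change (adj U *L U *L (adj U *L Y *L U) = adj U *L Y *L U).
by rewrite !lcompA -(lcompA _ U (adj U)) UU lcomp1r.
Qed.

End Compression.

(** * The matched projection inside [L(H)] *)

Section MatchedProjection.
Context {R : realType} {A : cstarAlgebra R} {H : hilbertModule A} {Q : linop H H}.
Hypothesis hQ : is_idempotent Q.

Let ax := linop_cstar (@ip_cauchy_schwarz _ _ H) (@hm_complete _ _ H).
Let P : linop H H := range_proj Q.
Let n : linop H H := Q - P.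

Lemma range_proj_spec :
  [/\ is_projection (range_proj Q), range_proj Q * Q = Q & Q * range_proj Q = range_proj Q].
Proof.
have [P0 [sP PP PQ QP]] := idempotent_range_projection ax hQ.
exact: (range_projP hQ (conj PP sP) PQ QP).
Qed.

Let PP : P * P = P. Proof. by have [[]] := range_proj_spec. Qed.
Let sP : adj P = P. Proof. by have [[]] := range_proj_spec. Qed.
Let PQ : P * Q = Q. Proof. by have [] := range_proj_spec. Qed.
Let QP : Q * P = P. Proof. by have [] := range_proj_spec. Qed.

Let U1 : linop H (range_mod Q) := matched_U1 Q.
Let U2 : linop H (null_mod Q) := matched_U2 Q.

Let rangeP x : sub_set (op_range Q) (P x).
Proof. by exists (P x) => //; exact: (congr1 (fun S : linop H H => S x) QP). Qed.

Let Prange x : sub_set (op_range Q) x -> P x = x.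
Proof. by case=> y _ <-; exact: (congr1 (fun S : linop H H => S y) PQ). Qed.

Let sE : adj (lid - P) = lid - P.
Proof. by rewrite adjB adj_lid sP. Qed.

Let nullE x : sub_set (op_null (adj Q)) ((lid - P) x).
Proof.
have e : adj Q * (lid - P) = 0.
  by rewrite -[adj Q * _]/(adj Q *L _) -sE -adj_comp -[_ *L _]/((1 - P) * Q)
    mulrBl mul1r PQ subrr (st0 ax).
exact: (congr1 (fun S : linop H H => S x) e).
Qed.

Let Enull x : sub_set (op_null (adj Q)) x -> (lid - P) x = x.
Proof.
have e : P = P * adj Q.
  by rewrite -{1}sP -{1}QP -[Q * P]/(Q *L P) adj_comp sP.
have eP y : P y = P (adj Q y) by exact: (congr1 (fun S : linop H H => S y) e).
move=> Qx; rewrite linopDE linopNE eP.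
by rewrite (_ : adj Q x = 0) // linop0 subr0.
Qed.

Let U1U1 : U1 *L adj U1 = lid. Proof. exact: proj_adj_proj sP rangeP Prange. Qed.
Let PE : adj U1 *L U1 = P. Proof. exact: adj_proj_proj sP rangeP Prange. Qed.
Let U2U2 : adj U2 *L U2 = lid - P. Proof. exact: adj_proj_proj sE nullE Enull. Qed.

Let nP : n * P = 0. Proof. by rewrite mulrBl QP PP subrr. Qed.
Let Pn : P * n = n. Proof. by rewrite mulrBr PQ PP. Qed.
Let nE : n * (1 - P) = n. Proof. by rewrite mulrBr mulr1 nP subr0. Qed.
Let En : (1 - P) * adj n = adj n.
Proof.
by rewrite -[RHS](congr1 (@adj _ _ _ _) nE) -[n * _]/(n *L _) adj_comp -[1 - P]/(lid - P) sE.
Qed.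

Let AE : matched_A Q = U1 *L n *L adj U2.
Proof.
apply: to_linop_eq => y; apply: val_inj.
change (\val (to_sub (op_range Q) (n (sub_val y))) = \val (U1 (n (adj U2 y)))).
have Pn' x : P (n x) = n x by exact: (congr1 (fun S : linop H H => S x) Pn).
rewrite (val_proj sP rangeP Prange) (adj_proj sE nullE Enull) Pn' val_to_sub //.
by rewrite -Pn'; exact: rangeP.
Qed.

Let cmp := compress U1.
Let exd := expand U1.

Let AAE : matched_A Q *L adj (matched_A Q) + lid = cmp (1 + n * adj n).
Proof.
rewrite AE !adj_comp adjK /cmp compressD (compress1 U1U1) addrC; congr (_ + _).
rewrite /compress -[n * adj n]/(n *L adj n) -[in RHS]En -[_ * adj n]/((lid - P) *L adj n).
by rewrite -U2U2 !lcompA.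
Qed.

Let nsP : adj n * P = adj n.
Proof.
by rewrite -[RHS](congr1 (@adj _ _ _ _) Pn) -[P * n]/(P *L n) adj_comp sP.
Qed.

Let PAA : P * (1 + n * adj n) = (1 + n * adj n) * P.
Proof.
by rewrite mulrDr [RHS]mulrDl mulr1 mul1r mulrA Pn -[n * adj n * P]mulrA nsP.
Qed.

Let B := matched_B Q.

(** Roots are available in [L(H)], where completeness is known. The root [h] of [1 + n * adj n]
    commutes with [P] and is compressed; the root [k] of [h] supplies the factorization that
    [op_pos] asks for. *)
Let B_spec : op_pos B /\ B * B = cmp (1 + n * adj n).
Proof.
rewrite -AAE; have pnn : @pos _ adj (1 + n * adj n).
  apply: (posD ax); first exact: (pos1 ax).
  by rewrite -{1}(adjK n); exact: (pos_stM ax).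
have [h [ph hh hc]] := sqrt_pos ax pnn.
have [k [pk kk kc]] := sqrt_pos ax ph.
have Ph : P * h = h * P by exact: hc PAA.
have Pk : P * k = k * P by exact: kc Ph.
apply: (@op_sqrtP _ _ _ (cmp h)).
  exists (cmp k); rewrite /cmp adj_compress (pos_sa ax pk).
  by rewrite -[RHS]/(compress U1 k * compress U1 k) compressM ?kk // PE.
by rewrite -[LHS]/(compress U1 h * compress U1 h) compressM ?PE // hh AAE.
Qed.

Let b := exd B.

Let pb : @pos _ adj b.
Proof.
have [[S BE] _] := B_spec.
rewrite /b BE /exd -[_ *L _]/(adj S * S) expandM // -adj_expand.
exact: (pos_stM ax).
Qed.

Let inv_spec (X : linop H H) : @pos _ adj X -> P * X = X * P ->
  let Y := cmp (1 + X) in op_inv Y * Y = 1 /\ Y * op_inv Y = 1.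
Proof.
move=> pX PX Y; have [w [_ w1 w2 wc]] := pos_inv1D ax pX.
have Pw : P * w = w * P by exact: wc.
have P1X : P * (1 + X) = (1 + X) * P by rewrite mulrDr mulrDl mulr1 mul1r PX.
apply: (@op_invP _ _ _ (cmp w)).
  by rewrite -[LHS]/(compress U1 w * compress U1 (1 + X)) compressM ?PE // w2 compress1.
by rewrite -[LHS]/(compress U1 (1 + X) * compress U1 w) compressM ?PE // w1 compress1.
Qed.

(** [B * B], the compression of [1 + n * adj n], has an inverse [Z] by [inv_spec]; as [Z] commutes
    with [B], [Z * B] inverts [B]. *)
Let invB_spec : op_inv B * B = 1 /\ B * op_inv B = 1.
Proof.
have pnn : @pos _ adj (n * adj n) by rewrite -{1}(adjK n); exact: (pos_stM ax).
have Pnn : P * (n * adj n) = (n * adj n) * P.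
  by have := PAA; rewrite mulrDr [RHS]mulrDl mulr1 mul1r => /addrI.
have [h1 h2] := inv_spec pnn Pnn; have [_ BB] := B_spec.
rewrite -/cmp -BB in h1 h2; set Z := op_inv (B * B) in h1 h2.
have e : Z * B = B * Z.
  by rewrite -[LHS]mulr1 -h2 !mulrA -[Z * B * B]mulrA h1 mul1r.
apply: (@op_invP _ _ _ (Z * B)).
  by rewrite -[LHS]/(Z * B * B) -mulrA.
by rewrite -[LHS]/(B * (Z * B)) e mulrA.
Qed.

(** [B + 1] is the compression of [1 + b] with [b] positive in [L(H)], so the two factors can be
    inverted separately. *)
Let invBB1_spec : op_inv (B * (B + 1)) * (B * (B + 1)) = 1 /\
  (B * (B + 1)) * op_inv (B * (B + 1)) = 1.
Proof.
have [h1 h2] := invB_spec.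
have Pb : P * b = b * P by rewrite -PE Pexpand // expandP.
have [g1 g2] := inv_spec pb Pb.
rewrite /cmp compressD (compress1 U1U1) (compressK U1U1) addrC in g1 g2.
set Z := op_inv (B + 1) in g1 g2; set W := op_inv B in h1 h2.
apply: (@op_invP _ _ _ (Z * W)).
  by rewrite -[LHS]/(Z * W * (B * (B + 1))) -mulrA [W * _]mulrA h1 mul1r.
by rewrite -[LHS]/(B * (B + 1) * (Z * W)) -mulrA [(B + 1) * _]mulrA g2 mul1r.
Qed.

Let beta := exd (op_inv B).
Let gamma := exd (op_inv (B * (B + 1))).

Let exd1 : exd 1 = P. Proof. by rewrite /exd expand1 PE. Qed.

Let AU2 : matched_A Q *L U2 = U1 *L n.
Proof.
by rewrite AE -lcompA U2U2 -lcompA -[n *L _]/(n * (1 - P)) nE.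
Qed.

Let U2A : adj U2 *L adj (matched_A Q) = adj n *L adj U1.
Proof. by rewrite -!adj_comp AU2. Qed.

(** [AU2] and [U2A] eliminate [U2]: each block becomes an expansion from R(Q), multiplied by [n] on
    the right or [adj n] on the left where [A] or its adjoint stood. *)
Let formulaE : matched_formula Q = lscal H (2^-1)%:C *
  ((b + P) * beta + beta * n + (adj n * beta + adj n * gamma * n)).
Proof.
rewrite /matched_formula -/U1 -/U2 -/B (lcompDr (adj U1)) (lcompDr (adj U2)).
have -> : adj U1 *L ((B + lid) *L op_inv B *L U1) = (b + P) * beta.
  have -> : (b + P) * beta = exd ((B + 1) * op_inv B).
    by rewrite /exd expandM // expandD -/exd exd1.
  by rewrite -[RHS]/(adj U1 *L ((B + lid) *L op_inv B) *L U1) !lcompA.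
have -> : adj U1 *L (op_inv B *L matched_A Q *L U2) = beta * n.
  by rewrite -[_ *L _ *L U2]lcompA AU2 !lcompA.
have -> : adj U2 *L (adj (matched_A Q) *L op_inv B *L U1) = adj n * beta.
  by rewrite -[RHS]/(adj n *L (adj U1 *L op_inv B *L U1)) !lcompA U2A.
have -> : adj U2 *L (adj (matched_A Q) *L op_inv (B *L (B + lid)) *L matched_A Q *L U2) =
    adj n * gamma * n.
  rewrite -[_ *L _ *L U2]lcompA AU2 !lcompA U2A -[RHS]/(adj n *L gamma *L n).
  by rewrite -[gamma]/(expand U1 (op_inv (B *L (B + lid)))) /expand !lcompA.
have -> : (2^-1 : R[i]) = (2^-1)%:C by rewrite fmorphV rmorph_nat.
exact: linop_ext.
Qed.

Lemma matched_formula_bounds : Q - range_proj Q != 0 ->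
  2^-1 * opnorm (Q - range_proj Q) < opnorm (matched_formula Q - Q) /\
  opnorm (matched_formula Q - Q) < opnorm (Q - range_proj Q).
Proof.
move=> n0; have [h1 h2] := invB_spec; have [g1 g2] := invBB1_spec.
have bP : b * P = b by rewrite -PE expandP.
apply: (@matched_norm_bounds _ _ _ _ _ ax P Q b beta gamma (gamma * b)) => //.
- have [_ BB] := B_spec.
  rewrite -[b * b]expandM // BB /cmp expand_compress PE PAA.
  rewrite -[_ * P * P]mulrA PP [LHS]mulrDl mul1r addrC.
  by rewrite -[n * adj n * P]mulrA nsP.
- by rewrite -[beta * b]expandM // h1.
- by rewrite -[b * beta]expandM // h2.
- by rewrite -PE expandP.
- by rewrite -exd1 -[b + _]expandD -[b * _]expandM // -[gamma * _]expandM // g1.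
- by rewrite -PE expandP.
Qed.

End MatchedProjection.

Theorem theorem4p11 (R : realType) (A : cstarAlgebra R) (H : hilbertModule A)
    (Q : linop H H) (hQ : is_idempotent Q) :
  [/\ 2^-1 * opnorm (range_proj Q - Q) <= opnorm (matched_proj Q - Q),
      opnorm (matched_proj Q - Q) <= opnorm (range_proj Q - Q),
      2^-1 * opnorm (range_proj Q - Q) = opnorm (matched_proj Q - Q)
        <-> is_projection Q &
      opnorm (matched_proj Q - Q) = opnorm (range_proj Q - Q)
        <-> is_projection Q].
Proof.
have CS := @ip_cauchy_schwarz R A H; have cH := @hm_complete R A H.
have [[PP sP] PQ QP] := range_proj_spec hQ.
have -> : range_proj Q - Q = - (Q - range_proj Q) by rewrite opprB.
rewrite (opnormN CS cH) /matched_proj.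
case: asboolP => [pQ|npQ].
  (* For selfadjoint [Q] with range projection [P], [P = adj (Q P) = P Q = Q]. *)
  have -> : range_proj Q = Q.
    by rewrite -sP -QP [LHS]adj_comp sP (proj2 pQ).
  by rewrite subrr (opnorm0 CS cH) mulr0.
have n0 : Q - range_proj Q != 0.
  by rewrite subr_eq0; apply: contra_notN npQ => /eqP ->.
have [lb ub] := matched_formula_bounds hQ n0.
split; [exact: ltW|exact: ltW| |]; split=> // e.
  by move: lb; rewrite e ltxx.
by move: ub; rewrite e ltxx.
Qed.
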